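(* There is no $2$-analog of a $(9,3,1)$-design that is cyclic, i.e. no $2$-analog of a $(9,3,1)$-design admits an automorphism (a collineation of $\mathrm{PG}(8,2)$ mapping blocks to blocks) that cyclically permutes all $511$ of its points.
   Context: A $(v,k,1)$-design is a pair $(V,\mathcal{B})$ with $V$ a $v$-set and $\mathcal{B}$ a collection of $k$-subsets such that every pair of distinct points lies in exactly one block. A $2$-analog of a $(9,3,1)$-design is a $(511,7,1)$-design whose point set is the point set of the projective space $\mathrm{PG}(8,2)$ (equivalently, the nonzero vectors of $\mathbb{F}_2^9$) and whose blocks are projective planes of $\mathrm{PG}(8,2)$ (i.e. the sets of nonzero vectors of $3$-dimensional subspaces of $\mathbb{F}_2^9$); thus every $2$-dimensional subspace of $\mathbb{F}_2^9$ lies in exactly one block. Automorphisms of such a $2$-analog are taken to be elements of $\mathrm{PGL}(9,2)$ leaving the set of blocks invariant; the design is cyclic if some automorphism permutes all points in a single cycle of length $511$. *)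

(* Defs.v *)
From HB Require Import structures.
From mathcomp Require Import all_boot all_order all_algebra all_fingroup.

Set Implicit Arguments.
Unset Strict Implicit.
Unset Printing Implicit Defensive.

Import GRing.Theory.
Local Open Scope ring_scope.

(** A (v,k,1)-design on the whole finite type [T]. *)
Definition is_design (T : finType) (v k : nat) (B : {set {set T}}) : Prop :=
  [/\ #|T| = v,
      forall b : {set T}, b \in B -> #|b| = k
    & forall x y : T, x != y ->
        exists! b : {set T}, [/\ b \in B, x \in b & y \in b]].

(** Points of PG(n-1,2): the only nonzero scalar of F_2 is 1, so a
    1-dimensional subspace is determined by its unique nonzero vector. *)
Definition point (n : nat) : finType := {x : 'rV['F_2]_n | x != 0}.

(** [n] and [k] are vector space dimensions: for [k = 3] a projective plane. *)
Definition is_subspace_block (n k : nat) (b : {set point n}) : Prop :=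
  exists2 U : {vspace 'rV['F_2]_n},
    \dim U = k & b = [set x : point n | val x \in U].

Definition is_two_analog (n k : nat) (B : {set {set point n}}) : Prop :=
  is_design (2 ^ n - 1) (2 ^ k - 1) B /\
  forall b : {set point n}, b \in B -> is_subspace_block k b.

(** PGL(n,2) as a permutation group on the points of PG(n-1,2); matrices act
    on row vectors from the right. *)
Definition PGL2 (n : nat) : {set {perm point n}} :=
  [set s : {perm point n} |
    [exists A : 'M['F_2]_n,
      (A \in unitmx) && [forall x : point n, val (s x) == val x *m A]]].

Definition is_automorphism (n : nat) (B : {set {set point n}})
    (s : {perm point n}) : Prop :=
  s \in PGL2 n /\ [set s @: b | b : {set point n} in B] = B.

Definition is_cyclic (n : nat) (B : {set {set point n}}) : Prop :=
  exists2 s : {perm point n},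
    is_automorphism B s & porbits s = [set [set: point n]].

(* Main.v *)
Require Import Defs.
From HB Require Import structures.
From mathcomp Require Import all_boot all_order all_algebra all_fingroup.
From mathcomp Require Import zify ring.

(* A cyclic automorphism A generates a field F_2[A] with 512 elements, in which
   there is a root M of the primitive polynomial x^9 + x^4 + 1; so the points
   become the exponents modulo 511 of M, and the design is invariant under
   translation of exponents.  The lines fall into 85 translation classes
   ("columns").  A plane of the design whose stabilizer is trivial has 42
   distinct differences, i.e. meets 7 distinct columns, and planes sharing a
   column are translates of each other.  As 42 does not divide 510, some plane
   has a stabilizer; it is then a coset of GF(8), and covers one column.  The
   other planes partition the remaining 84 columns into 7-sets taken from an
   explicit list of 1332, which is closed under the Frobenius map.  A
   backtracking search, in which an element refuted once is discarded together
   with its Frobenius orbit, shows that there is no such partition. *)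

Set Implicit Arguments.
Unset Strict Implicit.
Unset Printing Implicit Defensive.

(** * Exact covers by admissible sets of columns *)

(** Thirteen digits serve every index: [a <= 12] in the set number [12 a + b < 152], at most 9 for
    columns, and octal digits for exponents. *)
Inductive digit :=
  | D0 | D1 | D2 | D3 | D4 | D5 | D6 | D7 | D8 | D9 | D10 | D11 | D12.

Definition digits : seq digit :=
  [:: D0; D1; D2; D3; D4; D5; D6; D7; D8; D9; D10; D11; D12].

Definition num (d : digit) : nat :=
  match d with
  | D0 => 0 | D1 => 1 | D2 => 2 | D3 => 3 | D4 => 4 | D5 => 5 | D6 => 6
  | D7 => 7 | D8 => 8 | D9 => 9 | D10 => 10 | D11 => 11 | D12 => 12
  end.

Definition dig (n : nat) : digit := nth D0 digits n.

Lemma numK : cancel num dig.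
Proof. by case. Qed.

HB.instance Definition _ := Countable.copy digit (can_type numK).

Set Primitive Projections.
Record table (T : Type) := Table {
  at0 : T; at1 : T; at2 : T; at3 : T; at4 : T; at5 : T; at6 : T; at7 : T;
  at8 : T; at9 : T; at10 : T; at11 : T; at12 : T }.
Unset Primitive Projections.

Definition get (T : Type) (t : table T) (d : digit) : T :=
  match d with
  | D0 => at0 t | D1 => at1 t | D2 => at2 t | D3 => at3 t | D4 => at4 t
  | D5 => at5 t | D6 => at6 t | D7 => at7 t | D8 => at8 t | D9 => at9 t
  | D10 => at10 t | D11 => at11 t | D12 => at12 t
  end.

(* Under call-by-need evaluation the entries of [tab f] are computed at most
   once: [get (tab f)] is a memoized [f]. *)
Definition tab (T : Type) (f : digit -> T) : table T :=
  Table
    (f D0) (f D1) (f D2) (f D3) (f D4) (f D5) (f D6) (f D7) (f D8) (f D9)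
    (f D10) (f D11) (f D12).

Lemma get_tab (T : Type) (f : digit -> T) d : get (tab f) d = f d.
Proof. by case: d. Qed.

Definition table2 T := table (table T).
Definition table3 T := table (table (table T)).
Definition code2 := (digit * digit)%type.
Definition code3 := (digit * digit * digit)%type.

Definition get2 T (t : table2 T) (a b : digit) : T := get (get t a) b.
Definition get3 T (t : table3 T) (i : code3) : T :=
  let: (a, b, c) := i in get (get (get t a) b) c.
Definition tab2 T (f : digit -> digit -> T) : table2 T :=
  tab (fun a => tab (f a)).
Definition tab3 T (f : code3 -> T) : table3 T :=
  tab (fun a => tab (fun b => tab (fun c => f (a, b, c)))).

Lemma get_tab2 T (f : digit -> digit -> T) a b : get2 (tab2 f) a b = f a b.
Proof. by rewrite /get2 /tab2 !get_tab. Qed.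

Lemma get_tab3 T (f : code3 -> T) i : get3 (tab3 f) i = f i.
Proof. by case: i => [[a b] c]; rewrite /get3 /tab3 !get_tab. Qed.

Definition digit_eq_table := tab2 (fun a b => num a == num b).
Definition eq1 (a b : digit) : bool := get2 digit_eq_table a b.
Definition eq2 (c c' : code2) : bool := eq1 c.1 c'.1 && eq1 c.2 c'.2.
Definition eq3 (i j : code3) : bool := eq2 i.1 j.1 && eq1 i.2 j.2.

Lemma eq1E a b : eq1 a b = (a == b).
Proof. by rewrite /eq1 get_tab2 (inj_eq (can_inj numK)). Qed.

Lemma eq2E c c' : eq2 c c' = (c == c').
Proof. by rewrite /eq2 !eq1E -pair_eqE. Qed.

Lemma eq3E i j : eq3 i j = (i == j).
Proof. by rewrite /eq3 eq2E eq1E -pair_eqE. Qed.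

(* The column (o, k) is the image of the o-th line orbit under the k-th power of
   the Frobenius map (see [rep_table]); the tenth orbit, o = 9, has period 3. *)
Definition columns : seq code2 := Eval vm_compute in
  [seq c <- [seq (o, k) | o <- digits, k <- digits] |
     num c.2 < (if num c.1 < 9 then 9 else if num c.1 == 9 then 3 else 0)].

Definition frob_col (c : code2) : code2 :=
  let: (o, k) := c in
  (o, if (num k).+1 == (if num o < 9 then 9 else 3) then D0 else dig (num k).+1).

(* The sets of 7 distinct columns covered by planes, up to Frobenius: 146 orbits
   of length 9, then 6 of length 3.  They were found by enumerating the planes;
   that none is missing is [col_checkT]. *)
Definition orbit_reps : seq (seq code2) := [::
  [:: (D0,D0); (D0,D1); (D1,D0); (D3,D8); (D7,D2); (D1,D7); (D3,D5)];
  [:: (D0,D0); (D1,D0); (D0,D2); (D0,D3); (D2,D7); (D5,D0); (D8,D7)];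
  [:: (D0,D0); (D1,D0); (D0,D2); (D1,D1); (D3,D3); (D2,D5); (D6,D7)];
  [:: (D0,D0); (D1,D1); (D2,D0); (D4,D5); (D2,D6); (D4,D6); (D5,D7)];
  [:: (D0,D0); (D2,D0); (D0,D3); (D4,D0); (D2,D4); (D4,D2); (D7,D7)];
  [:: (D0,D0); (D2,D0); (D0,D3); (D3,D0); (D4,D1); (D6,D1); (D9,D1)];
  [:: (D0,D0); (D0,D3); (D1,D2); (D3,D7); (D4,D5); (D4,D1); (D7,D1)];
  [:: (D0,D0); (D0,D2); (D3,D7); (D2,D1); (D1,D6); (D6,D7); (D5,D6)];
  [:: (D0,D0); (D0,D2); (D1,D2); (D3,D7); (D2,D1); (D2,D7); (D8,D0)];
  [:: (D0,D0); (D1,D0); (D2,D7); (D0,D4); (D9,D0); (D8,D3); (D1,D7)];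
  [:: (D0,D0); (D0,D4); (D4,D0); (D4,D1); (D4,D3); (D5,D4); (D6,D8)];
  [:: (D0,D0); (D2,D7); (D0,D4); (D5,D0); (D6,D0); (D8,D6); (D3,D4)];
  [:: (D0,D0); (D6,D0); (D3,D1); (D8,D2); (D6,D5); (D8,D4); (D7,D7)];
  [:: (D0,D0); (D3,D1); (D7,D0); (D6,D4); (D4,D7); (D5,D4); (D6,D3)];
  [:: (D0,D0); (D7,D0); (D1,D3); (D4,D3); (D5,D1); (D3,D2); (D7,D6)];
  [:: (D0,D0); (D1,D3); (D2,D3); (D8,D5); (D4,D4); (D8,D3); (D1,D7)];
  [:: (D0,D0); (D1,D2); (D3,D8); (D8,D0); (D7,D3); (D8,D5); (D7,D2)];
  [:: (D0,D0); (D3,D7); (D8,D0); (D2,D2); (D7,D4); (D7,D8); (D8,D3)];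
  [:: (D0,D0); (D2,D2); (D1,D4); (D6,D1); (D9,D1); (D8,D8); (D5,D6)];
  [:: (D0,D0); (D0,D1); (D1,D4); (D2,D8); (D1,D8); (D2,D5); (D7,D7)];
  [:: (D0,D0); (D0,D1); (D2,D3); (D3,D8); (D2,D8); (D8,D7); (D5,D7)];
  [:: (D0,D0); (D1,D1); (D3,D0); (D4,D0); (D4,D5); (D4,D1); (D1,D5)];
  [:: (D0,D0); (D4,D1); (D9,D0); (D6,D1); (D7,D5); (D8,D1); (D3,D3)];
  [:: (D0,D0); (D1,D2); (D4,D5); (D4,D3); (D5,D1); (D5,D8); (D7,D2)];
  [:: (D0,D0); (D1,D0); (D5,D1); (D6,D4); (D4,D7); (D6,D2); (D6,D7)];
  [:: (D0,D0); (D3,D0); (D1,D4); (D6,D1); (D7,D5); (D3,D3); (D2,D5)];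
  [:: (D0,D0); (D8,D0); (D2,D2); (D6,D1); (D7,D3); (D7,D8); (D8,D3)];
  [:: (D0,D0); (D1,D3); (D7,D3); (D3,D2); (D4,D4); (D7,D4); (D9,D2)];
  [:: (D0,D0); (D5,D1); (D3,D2); (D5,D8); (D7,D1); (D6,D2); (D4,D8)];
  [:: (D0,D0); (D4,D5); (D5,D8); (D7,D1); (D2,D6); (D6,D2); (D4,D8)];
  [:: (D0,D0); (D4,D1); (D3,D2); (D7,D1); (D1,D8); (D6,D5); (D5,D4)];
  [:: (D0,D0); (D3,D1); (D1,D4); (D1,D8); (D7,D5); (D5,D2); (D5,D3)];
  [:: (D0,D0); (D3,D0); (D1,D4); (D9,D1); (D6,D5); (D4,D7); (D6,D2)];
  [:: (D0,D0); (D4,D0); (D2,D4); (D8,D2); (D1,D5); (D8,D4); (D6,D8)];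
  [:: (D0,D0); (D6,D0); (D7,D5); (D8,D1); (D1,D5); (D5,D2); (D8,D4)];
  [:: (D0,D0); (D6,D0); (D3,D1); (D8,D1); (D8,D5); (D5,D2); (D5,D7)];
  [:: (D0,D0); (D5,D0); (D6,D0); (D0,D5); (D8,D2); (D1,D5); (D5,D5)];
  [:: (D0,D0); (D6,D1); (D7,D3); (D7,D5); (D1,D5); (D8,D8); (D3,D3)];
  [:: (D0,D0); (D1,D1); (D2,D0); (D4,D3); (D7,D6); (D3,D6); (D6,D6)];
  [:: (D0,D0); (D5,D1); (D2,D4); (D8,D2); (D7,D6); (D4,D2); (D6,D3)];
  [:: (D0,D0); (D2,D0); (D9,D1); (D2,D4); (D2,D6); (D3,D6); (D6,D7)];
  [:: (D0,D0); (D1,D8); (D0,D6); (D0,D8); (D4,D6); (D1,D7); (D5,D3)];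
  [:: (D0,D0); (D3,D8); (D7,D6); (D4,D2); (D3,D6); (D4,D7); (D6,D3)];
  [:: (D0,D0); (D2,D2); (D1,D4); (D8,D5); (D4,D4); (D5,D2); (D8,D6)];
  [:: (D0,D0); (D3,D1); (D3,D8); (D1,D4); (D8,D5); (D4,D7); (D3,D5)];
  [:: (D0,D0); (D0,D5); (D5,D8); (D7,D1); (D6,D5); (D6,D2); (D4,D8)];
  [:: (D0,D0); (D3,D2); (D6,D5); (D8,D4); (D4,D8); (D7,D4); (D8,D7)];
  [:: (D0,D0); (D7,D3); (D8,D1); (D8,D5); (D7,D4); (D7,D8); (D2,D5)];
  [:: (D0,D0); (D1,D1); (D6,D1); (D7,D5); (D7,D8); (D3,D3); (D6,D6)];
  [:: (D0,D0); (D3,D0); (D7,D3); (D8,D1); (D3,D3); (D5,D5); (D9,D2)];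
  [:: (D0,D0); (D1,D0); (D9,D0); (D5,D1); (D3,D3); (D5,D5); (D7,D2)];
  [:: (D0,D0); (D7,D0); (D4,D3); (D7,D3); (D3,D2); (D7,D2); (D5,D4)];
  [:: (D0,D0); (D1,D3); (D4,D1); (D1,D5); (D7,D8); (D3,D3); (D6,D8)];
  [:: (D0,D0); (D2,D3); (D4,D5); (D1,D5); (D5,D5); (D7,D2); (D5,D7)];
  [:: (D0,D0); (D4,D0); (D0,D5); (D8,D2); (D4,D2); (D5,D5); (D9,D2)];
  [:: (D0,D0); (D8,D0); (D2,D2); (D8,D5); (D7,D8); (D8,D3); (D6,D8)];
  [:: (D0,D0); (D2,D0); (D7,D0); (D7,D6); (D4,D2); (D6,D3); (D3,D4)];
  [:: (D0,D0); (D0,D4); (D4,D6); (D7,D4); (D8,D3); (D6,D8); (D5,D3)];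
  [:: (D0,D0); (D2,D7); (D1,D3); (D8,D0); (D2,D2); (D7,D8); (D8,D3)];
  [:: (D0,D0); (D2,D1); (D3,D8); (D8,D0); (D3,D6); (D1,D6); (D6,D6)];
  [:: (D0,D0); (D1,D2); (D6,D4); (D5,D8); (D7,D1); (D6,D2); (D4,D8)];
  [:: (D0,D0); (D0,D2); (D3,D7); (D2,D1); (D7,D4); (D8,D7); (D2,D5)];
  [:: (D0,D0); (D0,D3); (D8,D4); (D9,D2); (D8,D7); (D7,D7); (D5,D6)];
  [:: (D0,D0); (D2,D0); (D6,D0); (D7,D7); (D5,D7); (D3,D4); (D6,D6)];
  [:: (D0,D0); (D1,D1); (D6,D1); (D8,D1); (D1,D5); (D2,D5); (D5,D7)];
  [:: (D0,D0); (D0,D1); (D6,D5); (D4,D7); (D8,D7); (D7,D7); (D3,D5)];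
  [:: (D0,D0); (D1,D1); (D3,D0); (D1,D2); (D4,D3); (D7,D3); (D7,D5)];
  [:: (D0,D0); (D2,D0); (D7,D0); (D4,D1); (D9,D0); (D4,D3); (D3,D2)];
  [:: (D0,D0); (D7,D0); (D4,D3); (D3,D2); (D5,D8); (D6,D8); (D5,D3)];
  [:: (D0,D0); (D3,D8); (D7,D6); (D4,D6); (D1,D7); (D5,D7); (D6,D6)];
  [:: (D0,D0); (D8,D0); (D2,D2); (D4,D4); (D7,D8); (D8,D3); (D6,D6)];
  [:: (D0,D0); (D9,D0); (D3,D2); (D4,D4); (D5,D2); (D8,D4); (D5,D3)];
  [:: (D0,D0); (D4,D0); (D1,D4); (D5,D4); (D8,D6); (D7,D7); (D5,D6)];
  [:: (D0,D0); (D1,D1); (D9,D1); (D2,D6); (D3,D6); (D6,D7); (D5,D6)];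
  [:: (D0,D0); (D1,D3); (D5,D1); (D2,D4); (D8,D8); (D3,D3); (D6,D7)];
  [:: (D0,D0); (D9,D1); (D2,D6); (D3,D6); (D6,D2); (D1,D6); (D6,D7)];
  [:: (D0,D0); (D0,D6); (D4,D2); (D3,D6); (D8,D8); (D9,D2); (D5,D6)];
  [:: (D0,D0); (D2,D1); (D9,D1); (D2,D6); (D3,D6); (D8,D8); (D6,D7)];
  [:: (D0,D0); (D5,D8); (D2,D4); (D2,D6); (D8,D8); (D6,D8); (D1,D6)];
  [:: (D0,D0); (D8,D0); (D4,D4); (D8,D4); (D7,D4); (D6,D8); (D1,D6)];
  [:: (D0,D0); (D6,D0); (D9,D0); (D8,D1); (D5,D2); (D5,D5); (D8,D6)];
  [:: (D0,D0); (D3,D1); (D2,D8); (D7,D2); (D5,D4); (D7,D7); (D5,D7)];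
  [:: (D0,D0); (D7,D0); (D1,D3); (D2,D2); (D7,D3); (D8,D8); (D6,D8)];
  [:: (D0,D0); (D3,D1); (D7,D0); (D9,D0); (D7,D2); (D1,D7); (D5,D3)];
  [:: (D0,D0); (D3,D7); (D4,D1); (D1,D8); (D7,D5); (D7,D8); (D2,D5)];
  [:: (D0,D0); (D2,D0); (D9,D0); (D6,D1); (D4,D6); (D8,D3); (D6,D6)];
  [:: (D1,D0); (D3,D0); (D2,D1); (D5,D1); (D7,D5); (D1,D7); (D3,D5)];
  [:: (D1,D0); (D1,D2); (D2,D7); (D1,D3); (D7,D6); (D5,D7); (D5,D3)];
  [:: (D1,D0); (D2,D1); (D4,D0); (D4,D1); (D4,D3); (D8,D2); (D8,D4)];
  [:: (D1,D0); (D2,D7); (D6,D0); (D1,D3); (D8,D0); (D6,D2); (D8,D7)];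
  [:: (D1,D0); (D1,D2); (D3,D1); (D2,D3); (D7,D5); (D8,D4); (D1,D6)];
  [:: (D1,D0); (D1,D3); (D8,D0); (D6,D4); (D6,D2); (D5,D7); (D5,D6)];
  [:: (D1,D0); (D2,D3); (D2,D2); (D6,D1); (D5,D8); (D9,D1); (D5,D3)];
  [:: (D1,D0); (D8,D0); (D2,D8); (D3,D6); (D8,D7); (D6,D3); (D3,D4)];
  [:: (D1,D0); (D3,D7); (D3,D1); (D2,D3); (D4,D1); (D3,D6); (D6,D3)];
  [:: (D1,D0); (D3,D0); (D5,D1); (D9,D1); (D4,D7); (D7,D4); (D7,D7)];
  [:: (D1,D0); (D3,D1); (D4,D3); (D6,D1); (D5,D8); (D8,D4); (D8,D6)];
  [:: (D1,D0); (D3,D7); (D3,D2); (D1,D8); (D9,D1); (D6,D5); (D4,D7)];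
  [:: (D1,D0); (D1,D4); (D5,D8); (D8,D8); (D4,D4); (D6,D3); (D5,D6)];
  [:: (D1,D0); (D7,D1); (D1,D8); (D9,D1); (D9,D2); (D1,D6); (D6,D6)];
  [:: (D1,D0); (D4,D5); (D8,D2); (D8,D1); (D2,D5); (D1,D7); (D6,D7)];
  [:: (D1,D0); (D3,D0); (D6,D4); (D6,D1); (D2,D4); (D7,D5); (D6,D8)];
  [:: (D1,D0); (D1,D5); (D2,D6); (D4,D6); (D7,D8); (D6,D8); (D5,D3)];
  [:: (D1,D0); (D4,D2); (D8,D8); (D5,D2); (D4,D8); (D6,D8); (D6,D6)];
  [:: (D1,D0); (D3,D1); (D8,D8); (D4,D4); (D4,D8); (D6,D3); (D3,D4)];
  [:: (D1,D0); (D5,D1); (D4,D2); (D4,D8); (D3,D3); (D3,D5); (D6,D7)];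
  [:: (D1,D0); (D5,D0); (D4,D5); (D1,D5); (D7,D6); (D2,D6); (D7,D8)];
  [:: (D1,D0); (D8,D1); (D8,D5); (D3,D6); (D2,D5); (D5,D7); (D5,D6)];
  [:: (D1,D0); (D8,D0); (D5,D8); (D6,D3); (D8,D6); (D5,D7); (D5,D3)];
  [:: (D1,D0); (D2,D0); (D1,D3); (D8,D0); (D6,D2); (D7,D8); (D5,D3)];
  [:: (D1,D0); (D4,D0); (D4,D3); (D8,D1); (D4,D8); (D6,D7); (D3,D4)];
  [:: (D1,D0); (D4,D5); (D4,D3); (D8,D1); (D7,D8); (D5,D6); (D3,D4)];
  [:: (D1,D0); (D2,D0); (D2,D3); (D4,D1); (D9,D0); (D6,D1); (D9,D2)];
  [:: (D1,D0); (D2,D2); (D5,D1); (D4,D6); (D6,D2); (D7,D7); (D5,D3)];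
  [:: (D1,D0); (D2,D3); (D2,D2); (D5,D1); (D7,D5); (D2,D6); (D4,D2)];
  [:: (D1,D0); (D7,D0); (D2,D2); (D2,D6); (D4,D6); (D8,D7); (D7,D7)];
  [:: (D1,D0); (D1,D3); (D8,D0); (D8,D2); (D6,D2); (D6,D7); (D3,D4)];
  [:: (D1,D0); (D2,D3); (D9,D0); (D5,D1); (D4,D6); (D3,D6); (D2,D5)];
  [:: (D1,D0); (D4,D1); (D9,D0); (D5,D8); (D3,D6); (D8,D4); (D8,D3)];
  [:: (D1,D0); (D2,D1); (D6,D4); (D7,D5); (D8,D4); (D4,D7); (D5,D4)];
  [:: (D2,D0); (D2,D1); (D6,D0); (D7,D3); (D7,D1); (D4,D4); (D7,D7)];
  [:: (D2,D0); (D2,D7); (D3,D1); (D5,D8); (D4,D6); (D5,D5); (D6,D7)];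
  [:: (D2,D0); (D3,D0); (D5,D0); (D3,D8); (D8,D8); (D6,D5); (D5,D3)];
  [:: (D2,D0); (D6,D0); (D3,D8); (D2,D2); (D6,D4); (D5,D8); (D8,D8)];
  [:: (D2,D0); (D7,D0); (D3,D8); (D4,D5); (D4,D1); (D8,D4); (D8,D3)];
  [:: (D2,D0); (D3,D1); (D8,D0); (D4,D5); (D4,D1); (D3,D2); (D4,D6)];
  [:: (D2,D0); (D3,D0); (D2,D7); (D3,D8); (D4,D1); (D5,D8); (D5,D6)];
  [:: (D2,D0); (D2,D1); (D4,D0); (D5,D1); (D7,D1); (D7,D5); (D8,D5)];
  [:: (D2,D0); (D2,D1); (D5,D8); (D4,D4); (D4,D7); (D6,D7); (D5,D6)];
  [:: (D2,D0); (D2,D7); (D3,D1); (D4,D3); (D3,D6); (D5,D2); (D5,D5)];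
  [:: (D2,D0); (D5,D0); (D7,D0); (D6,D1); (D6,D5); (D8,D3); (D6,D3)];
  [:: (D2,D0); (D3,D8); (D6,D4); (D4,D2); (D7,D4); (D5,D4); (D6,D3)];
  [:: (D2,D0); (D4,D5); (D9,D0); (D4,D7); (D3,D3); (D8,D7); (D8,D3)];
  [:: (D2,D0); (D7,D3); (D8,D5); (D4,D4); (D4,D7); (D9,D2); (D8,D6)];
  [:: (D2,D0); (D7,D1); (D2,D4); (D7,D5); (D8,D6); (D6,D8); (D6,D7)];
  [:: (D2,D0); (D4,D3); (D5,D1); (D5,D2); (D7,D4); (D5,D4); (D6,D8)];
  [:: (D2,D0); (D3,D8); (D4,D8); (D3,D3); (D8,D3); (D3,D4); (D5,D3)];
  [:: (D2,D0); (D5,D0); (D4,D2); (D7,D8); (D7,D7); (D3,D4); (D5,D3)];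
  [:: (D2,D0); (D3,D7); (D8,D8); (D6,D2); (D7,D2); (D3,D5); (D5,D3)];
  [:: (D2,D0); (D2,D2); (D6,D5); (D8,D4); (D4,D8); (D6,D3); (D3,D4)];
  [:: (D3,D0); (D9,D0); (D7,D1); (D8,D8); (D8,D4); (D7,D8); (D5,D3)];
  [:: (D3,D0); (D7,D0); (D7,D1); (D8,D2); (D4,D6); (D5,D5); (D9,D2)];
  [:: (D3,D0); (D3,D1); (D9,D0); (D8,D8); (D5,D4); (D5,D7); (D3,D4)];
  [:: (D3,D0); (D7,D3); (D7,D5); (D6,D2); (D3,D3); (D6,D3); (D3,D5)];
  [:: (D3,D0); (D7,D3); (D3,D6); (D8,D7); (D6,D3); (D8,D6); (D5,D3)];
  [:: (D4,D0); (D7,D3); (D8,D1); (D4,D7); (D7,D8); (D5,D5); (D9,D2)];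
  [:: (D0,D0); (D0,D3); (D2,D1); (D2,D7); (D9,D1); (D2,D4); (D0,D6)];
  [:: (D1,D0); (D1,D3); (D6,D4); (D6,D1); (D9,D2); (D1,D6); (D6,D7)];
  [:: (D1,D0); (D2,D0); (D1,D3); (D2,D3); (D9,D1); (D2,D6); (D1,D6)];
  [:: (D2,D0); (D2,D3); (D5,D1); (D2,D6); (D5,D4); (D9,D2); (D5,D7)];
  [:: (D4,D0); (D6,D0); (D4,D3); (D9,D1); (D4,D6); (D6,D3); (D6,D6)];
  [:: (D6,D0); (D7,D1); (D9,D1); (D7,D4); (D6,D3); (D7,D7); (D6,D6)]].

(* The triple (a, b, k) names the k-th Frobenius image of the set number
   12 a + b of [orbit_reps]. *)
Definition is_id (i : code3) : bool :=
  let: (a, b, k) := i in let r := num a * 12 + num b in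
  [&& num b < 12, r < 152 & num k < (if r < 146 then 9 else 3)].

Definition ids : seq code3 := Eval vm_compute in
  [seq i <- [seq (ab, k) | ab <- [seq (a, b) | a <- digits, b <- digits],
                           k <- digits] | is_id i].

Lemma mem_digits d : d \in digits.
Proof. by case: d. Qed.

Lemma mem_ids i : (i \in ids) = is_id i.
Proof.
have -> : ids = [seq i <- [seq (ab, k) |
    ab <- [seq (a, b) | a <- digits, b <- digits], k <- digits] | is_id i].
  by vm_compute.
case: i => [[a b] k]; rewrite mem_filter.
rewrite [_ \in _](_ : _ = true) ?andbT //.
by apply: allpairs_f (mem_digits k); apply: allpairs_f; exact: mem_digits.
Qed.

Definition orbit_rep_table :=
  tab2 (fun a b => nth [::] orbit_reps (num a * 12 + num b)).
Definition cols_table : table3 (seq code2) :=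
  tab3 (fun i : code3 => let: (a, b, k) := i in
    map (iter (num k) frob_col) (get2 orbit_rep_table a b)).
Definition cols (i : code3) : seq code2 := get3 cols_table i.

Definition frob_id (i : code3) : code3 :=
  let: (a, b, k) := i in
  let n := if num a * 12 + num b < 146 then 9 else 3 in
  (a, b, if (num k).+1 == n then D0 else dig (num k).+1).

Definition hit_table : table2 (table3 bool) :=
  tab2 (fun o k => tab3 (fun i => has (eq2 (o, k)) (cols i))).
Definition hit (c : code2) (i : code3) : bool :=
  get3 (get2 hit_table c.1 c.2) i.

Lemma hitE c i : hit c i = (c \in cols i).
Proof.
rewrite /hit get_tab2 get_tab3 -has_pred1 -surjective_pairing.
by apply: eq_has => c'; rewrite eq2E eq_sym.
Qed.

(** Compatible means disjoint or equal. As [i] is compatible with itself, the columns of [i] keep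
    [i] in their lists, so a cover through [i] still meets every list. The lookup descends digit by
    digit to share prefixes. *)
Definition compat_row (i : code3) : table3 bool :=
  let: (a0, b0, c0) := i in
  let hs := [seq get2 hit_table c.1 c.2 | c <- cols i] in
  tab (fun a => let hs := [seq get h a | h <- hs] in let ea := eq1 a a0 in
  tab (fun b => let hs := [seq get h b | h <- hs] in let eb := ea && eq1 b b0 in
  tab (fun c => has (fun h => get h c) hs ==> eb && eq1 c c0))).
Definition compat_table : table3 (table3 bool) := tab3 compat_row.

Lemma compat_rowE i j :
  get3 (compat_row i) j = (has (mem (cols j)) (cols i) ==> (i == j)).
Proof.
case: i j => [[a0 b0] c0] [[a b] c].
rewrite /get3 /compat_row !get_tab !has_map !eq1E; congr (_ ==> _).
  by apply: eq_has => d; rewrite -[RHS]/(d \in cols (a, b, c)) -hitE.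
by rewrite !xpair_eqE (eq_sym a0) (eq_sym b0) (eq_sym c0).
Qed.

(* Every element carries its own lookup function as a literal lambda term, which
   is what makes one compatibility test cheap for the kernel. *)
Record elt := Elt { name : code3; sel : table3 bool -> bool }.
Definition elt_of (i : code3) : elt := Elt i (fun r => get3 r i).
Definition elts : seq elt := Eval cbv in map elt_of ids.

Lemma eltsE : elts = map elt_of ids.
Proof. by []. Qed.

Definition compat (r : table3 bool) (e : elt) : bool := sel e r.

(** * Refutation certificates and their soundness *)

Definition lists := table2 (seq elt).
Definition restrict (L : lists) (r : table3 bool) : lists :=
  tab2 (fun o k => filter (compat r) (get2 L o k)).

(* A forest: each [Branch o k ch rest] treats one element, and says that once
   that element is chosen, column (o, k) is to be branched on, with [ch]
   treating the elements left in that column. *)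
Inductive cert := Stop | Branch (o k : digit) (ch rest : cert).

(** An empty list needs no certificate. A [Stop] as [ch] claims that the branching column keeps no
    compatible element, which is tested without building the restricted lists. *)
Fixpoint check (f : cert) (l : seq elt) (L : lists) : bool :=
  if l isn't e :: l' then true else
  if f isn't Branch o k ch rest then false else
  let r := get3 compat_table (name e) in
  match ch with
  | Stop => ~~ has (compat r) (get2 L o k)
  | _ => let L' := restrict L r in check ch (get2 L' o k) L'
  end && check rest l' L.

Definition remove_orbit (L : lists) (a b : digit) : lists :=
  tab2 (fun o k => [seq e <- get2 L o k | ~~ eq2 (a, b) (name e).1]).

Inductive cert_seq := CNil | CCons (a b : digit) (f : cert) (s : cert_seq).

(** Column [(D9, D0)] must be covered, so emptying its list is the contradiction. The Frobenius map
    permutes the three columns of the tenth line orbit transitively, so only the orbits of sets that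
    meet them need refuting. *)
Fixpoint check_seq (s : cert_seq) (L : lists) : bool :=
  match s with
  | CNil => nilp (get2 L D9 D0)
  | CCons a b f s' =>
      check f [:: elt_of (a, b, D0)] L && check_seq s' (remove_orbit L a b)
  end.

Definition col_table : table2 bool :=
  tab2 (fun o k => has (eq2 (o, k)) columns).
(** Pairs outside [columns] receive all elements, so that [meets] holds at every pair of digits
    without a side condition. *)
Definition root_lists : lists :=
  tab2 (fun o k => if get2 col_table o k
                   then filter (compat (get2 hit_table o k)) elts else elts).

Record exact_cover (X : code3 -> Prop) : Prop := ExactCover {
  cover_ids : forall i, X i -> i \in ids;
  cover_all : forall c, c \in columns -> exists2 i, X i & c \in cols i;
  cover_disjoint : forall i j c,
    X i -> X j -> c \in cols i -> c \in cols j -> i = j }.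

Definition meets (X : code3 -> Prop) (L : lists) : Prop :=
  forall o k, exists2 s, get2 L o k = map elt_of s & exists2 i, X i & i \in s.

Lemma cover_compat X i j : exact_cover X -> X i -> X j ->
  get3 (compat_row i) j.
Proof.
move=> hX Xi Xj; rewrite compat_rowE; apply/implyP => /hasP[c ci cj].
by apply/eqP; apply: cover_disjoint hX _ _ _ Xi Xj ci cj.
Qed.

Lemma meets_restrict X L i : exact_cover X -> meets X L -> X i ->
  meets X (restrict L (compat_row i)).
Proof.
move=> hX hL Xi o k; rewrite get_tab2; case: (hL o k) => s -> [j Xj js].
exists [seq j <- s | get3 (compat_row i) j]; first by rewrite filter_map.
by exists j; rewrite // mem_filter js (cover_compat hX).
Qed.

(** If [X] chose [i], restriction by [i] would preserve [meets], so the list of the branching column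
    would contain a member of [X]; but the subforest refutes that whole list. *)
Lemma check_sound X f s L : exact_cover X -> meets X L ->
  check f (map elt_of s) L -> forall i, i \in s -> ~ X i.
Proof.
move=> hX; elim: f s L => [|o k ch IHch rest IHrest] [|i s] L hL //=.
rewrite get_tab3 => /andP[chk_ch chk_rest] j.
rewrite inE => /predU1P[-> {j}|]; last exact: IHrest hL chk_rest j.
move=> Xi; case: ch IHch chk_ch => [_|o' k' ch' rest'] => [|IHch chk].
  case: (hL o k) => t -> [l Xl lt]; rewrite has_map => /hasPn/(_ l lt)/negP.
  by apply; apply: cover_compat hX Xi Xl.
have hL' := meets_restrict hX hL Xi; have [t Lt [l Xl lt]] := hL' o k.
by apply: (IHch t _ hL' _ l lt Xl); rewrite -Lt.
Qed.

Lemma meets_remove_orbit X L a b : meets X L -> (forall k, ~ X (a, b, k)) ->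
  meets X (remove_orbit L a b).
Proof.
move=> hL noX o k; rewrite get_tab2; case: (hL o k) => s -> [i Xi si].
exists [seq j <- s | ~~ eq2 (a, b) j.1]; first by rewrite filter_map.
exists i => //; rewrite mem_filter si andbT eq2E.
by apply: contra_notN (noX i.2) => /eqP ->; rewrite -surjective_pairing.
Qed.

Lemma meets_root X : exact_cover X -> meets X root_lists.
Proof.
move=> hX o k; rewrite get_tab2 eltsE get_tab2.
case: ifP => [|_]; last first.
  exists ids => //; have [//|i Xi _] := cover_all hX (c := (D0, D0)).
  by exists i; last exact: cover_ids hX _ Xi.
move=> /hasP[c ck]; rewrite eq2E => /eqP ck'; rewrite -{c}ck' in ck.
have [i Xi ci] := cover_all hX ck.
exists [seq i <- ids | hit (o, k) i]; first by rewrite filter_map.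
by exists i; rewrite // mem_filter hitE ci; exact: cover_ids hX _ Xi.
Qed.

(** * Frobenius symmetry of exact covers *)

Definition frob_id_inv := iter 8 frob_id.

Definition frob_col_inv := iter 8 frob_col.

(** All periods are 9 or 3, so the eighth iterate inverts the Frobenius map. *)
Lemma frob_idP i : i \in ids ->
  [/\ frob_id i \in ids /\ frob_id_inv i \in ids, frob_id (frob_id_inv i) = i,
      frob_id_inv (frob_id i) = i,
      {in cols i, forall c, frob_col c \in cols (frob_id i)} &
      {in cols i, forall c, frob_col_inv c \in cols (frob_id_inv i)}].
Proof.
suff /allP chk : all (fun i => let j := frob_id i in let j' := frob_id_inv i in
    [&& is_id j && is_id j', eq3 (frob_id j') i, eq3 (frob_id_inv j) i,
      all (fun c => hit (frob_col c) j) (cols i) &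
      all (fun c => hit (frob_col_inv c) j') (cols i)]) ids.
  move=> /chk/and5P[]; rewrite -!mem_ids !eq3E => /andP h /eqP h' /eqP h''.
  by move=> /allP h1 /allP h2; split=> // c => [/h1|/h2]; rewrite hitE.
by vm_compute.
Qed.

Lemma frob_colP c : c \in columns ->
  frob_col c \in columns /\ frob_col_inv (frob_col c) = c.
Proof.
suff /allP chk : all (fun c => (frob_col c \in columns) &&
    (frob_col_inv (frob_col c) == c)) columns.
  by move=> /chk/andP[-> /eqP ->].
by vm_compute.
Qed.

Definition frob_shift (X : code3 -> Prop) i := i \in ids /\ X (frob_id i).

Lemma exact_cover_frob X : exact_cover X -> exact_cover (frob_shift X).
Proof.
move=> hX; split=> [i []//|c cC|i j c [iI Xi] [jI Xj] ci cj].
  have [fC fK] := frob_colP cC; have [i Xi fi] := cover_all hX fC.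
  have iI := cover_ids hX Xi; have [[_ jI] fj _ _ h] := frob_idP iI.
  exists (frob_id_inv i); first by split; rewrite ?fj.
  by rewrite -fK; apply: h.
have [_ _ ki hi _] := frob_idP iI; have [_ _ kj hj _] := frob_idP jI.
by rewrite -ki -kj (cover_disjoint hX Xi Xj (hi c ci) (hj c cj)).
Qed.

Lemma frob_orbit a b k : (a, b, k) \in ids ->
  (a, b, D0) \in ids /\ iter (num k) frob_id (a, b, D0) = (a, b, k).
Proof.
suff /allP chk : all (fun i : code3 => is_id (i.1, D0) &&
    eq3 (iter (num i.2) frob_id (i.1, D0)) i) ids.
  by move=> /chk/andP[]; rewrite -mem_ids eq3E => -> /eqP.
by vm_compute.
Qed.

(** A cover through [(a, b, k)] becomes, after [num k] Frobenius shifts, a cover through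
    [(a, b, D0)]. *)
Lemma avoid_orbit a b : (forall X, exact_cover X -> ~ X (a, b, D0)) ->
  forall X k, exact_cover X -> ~ X (a, b, k).
Proof.
move=> noX X k hX Xk; have [oI fk] := frob_orbit (cover_ids hX Xk).
have: X (iter (num k) frob_id (a, b, D0)) by rewrite fk.
elim: (num k) X hX {Xk fk} => [|n IHn] X hX; first exact: noX.
rewrite iterS => Xn; apply: (IHn _ (exact_cover_frob hX)); split=> //.
elim: n {IHn Xn} => //= n nI; by have [[]] := frob_idP nI.
Qed.

(** The hypothesis speaks of all covers at once because discarding an orbit also uses the Frobenius
    shifts of a cover. *)
Lemma check_seq_sound s L : (forall X, exact_cover X -> meets X L) ->
  check_seq s L -> forall X, ~ exact_cover X.
Proof.
elim: s L => [|a b f s IHs] L hL /=.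
  move=> /nilP L0 X hX; have [t Lt [i _]] := hL X hX D9 D0.
  by move: Lt; rewrite [LHS]L0; case: t.
move=> /andP[chk /IHs]; apply=> X hX; apply: meets_remove_orbit (hL X hX) _ => k.
apply: avoid_orbit hX => {}X hX.
by apply: (check_sound hX (hL X hX) (s := [:: (a, b, D0)]) chk); rewrite inE.
Qed.

Lemma no_cover_of_check s : check_seq s root_lists -> forall X, ~ exact_cover X.
Proof. by apply: check_seq_sound => X; exact: meets_root. Qed.

(** * Unverified search that produces the certificate *)

Record pending := Pending {
  pcol : code2; phit : table3 bool; plist : seq elt; psize : nat }.

Definition narrow (r : table3 bool) (p : pending) : pending :=
  let l := filter (compat r) (plist p) in
  Pending (pcol p) (phit p) l (size l).

(** Columns that [e] covers are dropped, and a column left empty is returned at once as the best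
    choice. [done] accumulates in reverse order. *)
Fixpoint narrow_all e r (ps done : seq pending) (best : option pending) :=
  if ps isn't p :: ps' then (done, best) else
  if compat (phit p) e then narrow_all e r ps' done best else
  let q := narrow r p in
  if psize q == 0 then ([::], Some q) else
  let better := if best is Some b then psize q < psize b else true in
  narrow_all e r ps' (q :: done) (if better then Some q else best).

(* Branches on a column with the fewest elements left.  A nonzero entry [w] of
   [widths] keeps, from that depth on, only the [w] shortest columns. *)
Fixpoint search (widths : seq nat) (l : seq elt) (ps : seq pending) : cert :=
  if widths isn't w :: widths' then Stop else
  (fix search_list l := if l isn't e :: l' then Stop else
    let (qs, best) := narrow_all e (get3 compat_table (name e)) ps [::] None in
    let qs' := if w == 0 then rev qs else
               take w (sort (fun p q => psize p <= psize q) qs) in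
    if best isn't Some q then Stop else
    Branch (pcol q).1 (pcol q).2 (search widths' (plist q) qs')
      (search_list l')) l.

(** The initial size 0 is a placeholder: [narrow] recomputes sizes before they are compared. *)
Fixpoint search_seq (n : nat) (widths : seq nat) (L : lists) : cert_seq :=
  if n isn't n'.+1 then CNil else
  if get2 L D9 D0 isn't e :: _ then CNil else
  let: (a, b, _) := name e in
  let ps := [seq Pending c (get2 hit_table c.1 c.2) (get2 L c.1 c.2) 0
            | c <- columns] in
  CCons a b (search widths [:: elt_of (a, b, D0)] ps)
    (search_seq n' widths (remove_orbit L a b)).

(** * Lines and planes in terms of exponents modulo 511 *)

Definition code_of (n : nat) : code3 :=
  (dig (n %/ 64), dig (n %/ 8 %% 8), dig (n %% 8)).
Definition nat_of (e : code3) : nat :=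
  let: (a, b, c) := e in (num a * 8 + num b) * 8 + num c.
Definition code0 : code3 := (D0, D0, D0).

Definition digit_sum_table : table2 ((digit * bool) * (digit * bool)) :=
  let split s := if s < 8 then (dig s, false) else (dig (s - 8), true) in
  tab2 (fun a b => (split (num a + num b), split (num a + num b).+1)).
Definition add_digit (a b : digit) (carry : bool) : digit * bool :=
  let p := get2 digit_sum_table a b in if carry then p.2 else p.1.
Definition add_carry (x y : code3) (carry : bool) : code3 * bool :=
  let: (a, b, c) := x in let: (a', b', c') := y in
  let (c'', carry) := add_digit c c' carry in
  let (b'', carry) := add_digit b b' carry in
  let (a'', carry) := add_digit a a' carry in
  ((a'', b'', c''), carry).
(* Three octal digits with end-around carry compute modulo 8 ^ 3 - 1 = 511;
   777 is the second representation of zero. *)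
Definition addc (x y : code3) : code3 :=
  let (s, carry) := add_carry x y false in
  if carry then (add_carry s code0 true).1
  else if eq3 s (D7, D7, D7) then code0 else s.
Definition neg_digit_table := tab (fun d => dig (7 - num d)).
(** Complementing each octal digit subtracts from 777, that is, from 511; zero is treated apart
    because 777 is not canonical. *)
Definition negc (x : code3) : code3 :=
  let: (a, b, c) := x in if eq3 x code0 then code0 else
  (get neg_digit_table a, get neg_digit_table b, get neg_digit_table c).

Definition canonical (e : code3) : bool :=
  let: (a, b, c) := e in
  [&& num a < 8, num b < 8, num c < 8 & nat_of e < 511].

Lemma add_digitP a b carry : num a < 8 -> num b < 8 ->
  let (s, carry') := add_digit a b carry in
  num s < 8 /\ num s + 8 * carry' = num a + num b + carry.
Proof.
by rewrite /add_digit get_tab2; case: carry; case: a => //; case: b.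
Qed.

Lemma add_carryP x y carry : canonical x -> canonical y ->
  let (s, carry') := add_carry x y carry in let: (a, b, c) := s in
  [/\ num a < 8, num b < 8, num c < 8 &
      nat_of s + 512 * carry' = nat_of x + nat_of y + carry].
Proof.
case: x y => [[a b] c] [[a' b'] c'] /and4P[ha hb hc _] /and4P[ha' hb' hc' _].
rewrite /add_carry; case: add_digit (add_digitP carry hc hc') => c2 k1 [? e1].
case: add_digit (add_digitP k1 hb hb') => b2 k2 [? e2].
case: add_digit (add_digitP k2 ha ha') => a2 k3 [? e3]; split=> //.
rewrite /nat_of; lia.
Qed.

Lemma canonical_digits (a b c : digit) : num a < 8 -> num b < 8 -> num c < 8 ->
  (a, b, c) != (D7, D7, D7) -> canonical (a, b, c).
Proof. by case: a => //; case: b => //; case: c. Qed.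

Lemma addcP x y : canonical x -> canonical y ->
  canonical (addc x y) /\ nat_of (addc x y) = (nat_of x + nat_of y) %% 511.
Proof.
move=> hx hy; rewrite /addc; have := add_carryP false hx hy.
have lx : nat_of x < 511 by case: (x) hx => [[? ?] ?] /and4P[].
have ly : nat_of y < 511 by case: (y) hy => [[? ?] ?] /and4P[].
case: add_carry => [[[a b] c] k] [ha hb hc]; rewrite addn0.
case: k => [|]; rewrite ?muln1 ?muln0 ?addn0 => e.
  (* After a carry the digits hold [x + y - 512], at most 508; the end-around carry turns this into
     [x + y - 511]. *)
  have hs : canonical (a, b, c).
    apply/and4P; split=> //; lia.
  have := add_carryP true hs (isT : canonical code0).
  case: add_carry => [[[a2 b2] c2] k] [ha2 hb2 hc2].
  rewrite [nat_of code0]/= addn0 => e2.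
  have -> : (nat_of x + nat_of y) = nat_of (a2, b2, c2) + 511 by case: k e2; lia.
  have l2 : nat_of (a2, b2, c2) < 511 by case: k e2; lia.
  by rewrite modnDr modn_small //; split=> //; apply/and4P.
rewrite eq3E -e; case: eqP => [->|/eqP ne]; first by [].
have cs := canonical_digits ha hb hc ne; split=> //.
by rewrite modn_small //; case/and4P: cs.
Qed.

Lemma code_ofK n : n < 511 -> canonical (code_of n) /\ nat_of (code_of n) = n.
Proof.
move=> ltn; suff /allP/(_ n) : all (fun n => canonical (code_of n) &&
    (nat_of (code_of n) == n)) (iota 0 511).
  by rewrite mem_iota => /(_ ltn)/andP[-> /eqP].
by vm_compute.
Qed.

Lemma nat_ofK e : canonical e -> code_of (nat_of e) = e.
Proof.
case: e => [[a b] c]; apply: contraTeq; rewrite -eq3E.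
by case: a => //; case: b => //; case: c.
Qed.

Lemma negcP x : canonical x ->
  canonical (negc x) /\ nat_of (negc x) = (511 - nat_of x) %% 511.
Proof.
move=> hx; have ltx : nat_of x < 511 by case: x hx => [[? ?] ?] /and4P[].
suff /allP/(_ (nat_of x)) : all (fun n => canonical (negc (code_of n)) &&
    (nat_of (negc (code_of n)) == (511 - n) %% 511)) (iota 0 511).
  by rewrite mem_iota nat_ofK // => /(_ ltx)/andP[-> /eqP].
by vm_compute.
Qed.

(** * Zech logarithms, line orbits and the finite checks *)

Definition mulx (s : seq bool) : seq bool :=
  if s is [:: b0; b1; b2; b3; b4; b5; b6; b7; b8]
  then [:: b8; b0; b1; b2; b3 (+) b8; b4; b5; b6; b7] else s.
Definition add1 (s : seq bool) : seq bool :=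
  if s is b :: s' then ~~ b :: s' else s.
Definition powers : seq (seq bool) := traject mulx (true :: nseq 8 false) 511.

(** The Zech logarithm: [1 + x ^ e = x ^ (zech e)], so [zech e] is the third point of the line
    through 0 and [e]. At [e = 0] the sum vanishes and the entry is junk. *)
Definition zech_table : table3 code3 := tab3 (fun e =>
  code_of (index (add1 (nth [::] powers (nat_of e))) powers)).
Definition zech (e : code3) : code3 := get3 zech_table e.

(* The exponents of representatives of the line orbits: (o, k) is the orbit of
   the line through x ^ 0 and x ^ (2 ^ k * n) with [n] the o-th number, and
   (9, 3) is the orbit of the lines in the cosets of GF(8), which is generated
   by x ^ 73. *)
Definition gf8_col : code2 := (D9, D3).
Definition no_col : code2 := (D9, D9).
Definition all_cols : seq code2 := gf8_col :: columns.
Definition rep_table : table2 code3 := tab2 (fun o k =>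
  if eq2 (o, k) gf8_col then code_of 73 else
  iter (num k) (fun e => addc e e)
    (code_of (nth 0 [:: 1; 3; 7; 11; 17; 19; 21; 23; 27; 35] (num o)))).
Definition rep (c : code2) : code3 := get2 rep_table c.1 c.2.
Definition subc (x y : code3) : code3 := addc x (negc y).

(** The six differences of the base line [{0, r, w}]. As 85 * 6 = 510, every nonzero residue belongs
    to exactly one column. *)
Definition col_diffs_table : table2 (seq code3) := tab2 (fun o k =>
  let r := rep (o, k) in let w := zech r in
  [:: r; negc r; w; negc w; subc w r; subc r w]).
Definition col_diffs (c : code2) : seq code3 := get2 col_diffs_table c.1 c.2.
(** Residue 0 is in no list of differences, so [find] runs off the end and the default [no_col]
    results. *)
Definition line_col_table : table3 code2 := tab3 (fun e =>
  nth no_col all_cols (find (fun c => has (eq3 e) (col_diffs c)) all_cols)).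
Definition line_col (e : code3) : code2 := get3 line_col_table e.

Definition codes : seq code3 := [seq code_of n | n <- iota 0 511].

(** The last conjunct says that one of the three translates of the base line through 0 is the line
    [{0, d, zech d}]. Canonicity of [zech d] excludes a junk entry. *)
Definition line_check (d : code3) : bool :=
  let c := line_col d in let r := rep c in let w := zech r in
  [&& has (eq2 c) all_cols, eq2 (line_col (negc d)) c, has (eq3 d) (col_diffs c),
      canonical (zech d) &
      has (fun s => all (fun p => has (eq3 (addc s p)) [:: code0; d; zech d])
                        [:: code0; r; w]) [:: code0; negc r; negc w]].

Fixpoint uniq3 (s : seq code3) : bool :=
  if s is e :: s' then ~~ has (eq3 e) s' && uniq3 s' else true.

(** A plane stabilized by [s] is closed under adding [s], which rules out eight distinct multiples.
    As 511 = 7 * 73, any other nonzero [s] has order 7, and its multiples are the exponents of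
    GF(8). *)
Definition stabilizer_check (s : code3) : bool :=
  uniq3 (traject (addc s) code0 8) ||
  uniq3 (traject (addc s) code0 7) &&
  all (fun p => all (fun q =>
    eq3 p q || eq2 (line_col (subc q p)) gf8_col) (traject (addc s) code0 7))
    (traject (addc s) code0 7).

Fixpoint differences (s : seq code3) : seq code3 :=
  if s is p :: s' then [seq subc q p | q <- s'] ++ differences s' else [::].

(** The exponents of the nonzero combinations of [1], [x ^ r] and [x ^ j]; the last two are
    [x ^ r + x ^ j] and [x ^ w + x ^ j] with a power factored out. *)
Definition plane (r j : code3) : seq code3 :=
  let w := zech r in
  [:: code0; r; w; j; zech j; addc r (zech (subc j r)); addc w (zech (subc j w))].

Fixpoint undup2 (s : seq code2) : seq code2 :=
  if s is c :: s' then if has (eq2 c) s' then undup2 s' else c :: undup2 s'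
  else [::].

Definition col_ids_table : table2 (seq code3) :=
  tab2 (fun o k => filter (hit (o, k)) ids).
Definition col_ids (c : code2) : seq code3 := get2 col_ids_table c.1 c.2.

(** A plane outside the list must have distinct points (no [no_col]) and yet a GF(8) line or fewer
    than 7 columns; both are impossible for a plane of the design with a column in [columns]. *)
Definition plane_check (r : code3) (cand : table2 (seq code3)) (j : code3) :=
  let cs := map line_col (differences (plane r j)) in
  let c := line_col j in
  has (fun i => all (fun c => hit c i) cs) (get2 cand c.1 c.2) ||
  [&& ~~ has (eq2 no_col) cs &
      has (eq2 gf8_col) cs || (size (undup2 cs) < 7)].

Definition rep_check (c : code2) : bool :=
  let r := rep c in
  [&& canonical r, ~~ eq3 r code0 & eq2 (line_col r) c].

(** A plane with column [c] has a translate containing [{0, r, w}], which is determined by any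
    further point [j]: 508 tests per column. *)
Definition col_check (c : code2) : bool :=
  let r := rep c in let w := zech r in
  let cand := tab2 (fun o k => filter (hit (o, k)) (col_ids c)) in
  all (fun j => has (eq3 j) [:: code0; r; w] || plane_check r cand j) codes.

Definition ids_check (i : code3) : bool :=
  let c := head no_col (cols i) in
  all (fun j => all (fun c => hit c j) (cols i) ==> eq3 i j) (col_ids c) &&
  all (fun c => has (eq2 c) columns) (cols i) && (size (cols i) == 7).

Lemma line_checkT : all line_check (behead codes).
Proof. by vm_compute. Qed.

Lemma stabilizer_checkT : all stabilizer_check (behead codes).
Proof. by vm_compute. Qed.

Lemma ids_checkT : all ids_check ids.
Proof. by vm_compute. Qed.

Lemma rep_checkT : all rep_check all_cols.
Proof. by vm_compute. Qed.

Lemma col_checkT : all col_check columns.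
Proof. by vm_compute. Qed.

(** * Transfer of the computations to residues modulo 511 *)

Local Open Scope ring_scope.
Import GRing.Theory.

(* Naming the modulus spares the unification of unary numerals. *)
Definition n511 : nat := 511%N.

Definition of_code (e : code3) : 'Z_n511 := inZp (nat_of e).
Definition cod (x : 'Z_n511) : code3 := code_of x.

Lemma cod_canonical x : canonical (cod x).
Proof. by have [] := code_ofK (ltn_ord x). Qed.

Lemma codK : cancel cod of_code.
Proof.
move=> x; have [_ e] := code_ofK (ltn_ord x); apply/val_inj.
by rewrite [LHS](_ : _ = nat_of (cod x) %% 511)%N // [nat_of _]e modn_small.
Qed.

Lemma of_codeK e : canonical e -> cod (of_code e) = e.
Proof.
move=> he; rewrite /cod [nat_of_ord _](_ : _ = nat_of e %% 511)%N //.
by rewrite modn_small ?nat_ofK //; case: e he => [[? ?] ?] /and4P[].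
Qed.

Lemma of_codeD x y : canonical x -> canonical y ->
  of_code (addc x y) = of_code x + of_code y.
Proof.
move=> hx hy; have [_ e] := addcP hx hy.
by apply/val_inj; rewrite /= e modn_mod modnDm.
Qed.

Lemma of_codeN x : canonical x -> of_code (negc x) = - of_code x.
Proof.
move=> hx; have [_ e] := negcP hx.
have lx : (nat_of x < 511)%N by case: (x) hx => [[? ?] ?] /and4P[].
by apply/val_inj; rewrite /= e modn_mod (modn_small lx).
Qed.

Lemma codD x y : cod (x + y) = addc (cod x) (cod y).
Proof.
have hx := cod_canonical x; have hy := cod_canonical y.
rewrite -[x in LHS]codK -[y in LHS]codK -of_codeD // of_codeK //.
by case: (addcP hx hy).
Qed.

Lemma codN x : cod (- x) = negc (cod x).
Proof.
have hx := cod_canonical x.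
by rewrite -[x in LHS]codK -of_codeN // of_codeK //; case: (negcP hx).
Qed.

Lemma codB x y : cod (x - y) = subc (cod x) (cod y).
Proof. by rewrite codD codN. Qed.

Lemma cod0 : cod 0 = code0.
Proof. by []. Qed.

Lemma cod_inj : injective cod.
Proof. exact: can_inj codK. Qed.

Lemma cod_codes x : cod x \in codes.
Proof. by rewrite /codes /cod map_f // mem_iota ltn_ord. Qed.

Lemma cod_nonzero x : x != 0 -> cod x \in behead codes.
Proof.
move=> nx; have := cod_codes x; rewrite [codes]lock /= -lock.
rewrite -[codes]/(code0 :: behead codes) inE -cod0 (inj_eq cod_inj) (negPf nx).
by [].
Qed.

Definition colz (d : 'Z_n511) : code2 := line_col (cod d).
Definition zechz (d : 'Z_n511) : 'Z_n511 := of_code (zech (cod d)).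
Definition repz (c : code2) : 'Z_n511 := of_code (rep c).

Lemma repzP c : c \in all_cols ->
  [/\ cod (repz c) = rep c, repz c != 0 & colz (repz c) = c].
Proof.
move=> /(allP rep_checkT)/and3P[hr n0]; rewrite eq2E => /eqP e.
rewrite /colz /repz of_codeK // e; split=> //.
by rewrite -(inj_eq cod_inj) of_codeK // cod0 -eq3E.
Qed.

Lemma cod_zechz d : d != 0 -> cod (zechz d) = zech (cod d).
Proof.
move=> /cod_nonzero/(allP line_checkT)/and5P[_ _ _ h _].
by rewrite /zechz of_codeK.
Qed.

Lemma colzN d : d != 0 -> colz (- d) = colz d.
Proof.
move=> /cod_nonzero/(allP line_checkT)/and5P[_ /[!eq2E]/eqP + _ _ _].
by rewrite /colz codN.
Qed.

Lemma colz_all d : d != 0 -> colz d \in all_cols.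
Proof.
move=> /cod_nonzero/(allP line_checkT)/andP[+ _].
by rewrite -has_pred1; apply: sub_has => c; rewrite /= eq2E eq_sym.
Qed.

Lemma has_eq3 x s : has (eq3 x) s = (x \in s).
Proof. by rewrite -has_pred1; apply: eq_has => y; rewrite /= eq3E eq_sym. Qed.

Lemma has_eq2 x s : has (eq2 x) s = (x \in s).
Proof. by rewrite -has_pred1; apply: eq_has => y; rewrite /= eq2E eq_sym. Qed.

Lemma col_diffsP d : d != 0 -> cod d \in col_diffs (colz d).
Proof.
by move=> /cod_nonzero/(allP line_checkT)/and5P[_ _ + _ _]; rewrite has_eq3.
Qed.

Lemma line_translate d : d != 0 -> exists s, forall p,
  p \in [:: 0; repz (colz d); zechz (repz (colz d))] ->
  s + p \in [:: 0; d; zechz d].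
Proof.
move=> nd; set r := repz _; have [er nr _] := repzP (colz_all nd).
have := allP line_checkT _ (cod_nonzero nd) => /and5P[_ _ _ _].
rewrite -/(colz d) -er -cod_zechz // -cod_zechz // -cod0 -!codN.
rewrite -[[:: cod 0; cod (- r); _]]/(map cod [:: 0; - r; - zechz r]) has_map.
move=> /hasP[s _ /allP h]; exists s => p hp.
have /h : cod p \in map cod [:: 0; r; zechz r] by apply: map_f.
rewrite has_eq3 -codD -[[:: cod 0; _; _]]/(map cod [:: 0; d; zechz d]).
by rewrite (mem_map cod_inj).
Qed.

(** * Translation-invariant systems of planes *)

Definition translate (b : {set 'Z_n511}) (k : 'Z_n511) : {set 'Z_n511} :=
  [set x + k | x in b].

(** The design read on exponents: [plane_line] adds the third point of a line, by
    [x ^ a + x ^ b = x ^ (a + zech (b - a))], and [plane_step] is multiplication by the root. *)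
Record cyclic_planes (Bk : {set {set 'Z_n511}}) : Prop := CyclicPlanes {
  plane_card : forall b, b \in Bk -> #|b| = 7%N;
  plane_ex : forall x y, x != y -> exists2 b, b \in Bk & x \in b /\ y \in b;
  plane_uniq : forall b b' x y, b \in Bk -> b' \in Bk -> x != y ->
    x \in b -> y \in b -> x \in b' -> y \in b' -> b = b';
  plane_line : forall b x y, b \in Bk -> x \in b -> y \in b -> x != y ->
    x + zechz (y - x) \in b;
  plane_step : forall b, b \in Bk -> translate b 1 \in Bk }.

Definition has_col (b : {set 'Z_n511}) (c : code2) : Prop :=
  exists x y, [/\ x \in b, y \in b, x != y & colz (y - x) = c].

Lemma mem_translate b k x : (x \in translate b k) = (x - k \in b).
Proof.
apply/imsetP/idP => [[y yb ->]|xb]; first by rewrite addrK.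
by exists (x - k); rewrite ?subrK.
Qed.

Lemma has_col_translate b k c : has_col (translate b k) c <-> has_col b c.
Proof.
split=> [[x [y [xb yb nxy <-]]]|[x [y [xb yb nxy <-]]]].
  exists (x - k), (y - k); rewrite -!mem_translate; split=> //.
    by rewrite (inj_eq (addIr _)).
  by rewrite opprB addrA subrK.
exists (x + k), (y + k); rewrite !mem_translate !addrK; split=> //.
  by rewrite (inj_eq (addIr _)).
by rewrite opprD addrACA subrr addr0.
Qed.

Section CyclicPlanes.

Variables (Bk : {set {set 'Z_n511}}) (hB : cyclic_planes Bk).

Lemma translate_plane b k : b \in Bk -> translate b k \in Bk.
Proof.
move=> bB; rewrite -[k]natr_Zp; elim: (nat_of_ord k) => [|n IHn].
  suff -> : translate b 0%:R = b by [].
  by apply/setP => x; rewrite mem_translate subr0.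
suff -> : translate b n.+1%:R = translate (translate b n%:R) 1.
  exact: plane_step.
by apply/setP => x; rewrite !mem_translate -natr1 opprD addrA addrAC.
Qed.

Lemma translate_eq b b' x x' d : b \in Bk -> b' \in Bk -> d != 0 ->
  x \in b -> x + d \in b -> x' \in b' -> x' + d \in b' ->
  b' = translate b (x' - x).
Proof.
move=> bB b'B nd xb xdb xb' xdb'.
apply: (plane_uniq hB b'B (translate_plane _ bB) _ xb' xdb').
- by rewrite -subr_eq0 (_ : _ - _ = - d) ?oppr_eq0 //; ring.
- by rewrite mem_translate opprB addrC subrK.
- by rewrite mem_translate (_ : _ - _ = x + d) //; ring.
Qed.

Lemma col_point b c : b \in Bk -> has_col b c ->
  exists2 t, c \in all_cols &
    {subset [:: t; t + repz c; t + zechz (repz c)] <= b}.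
Proof.
move=> bB [x [y [xb yb nxy <-]]]; have nd : y - x != 0 by rewrite subr_eq0 eq_sym.
have [s hs] := line_translate nd; exists (x + s); first exact: colz_all.
have {}hs p : p \in [:: 0; repz (colz (y - x)); zechz (repz (colz (y - x)))] ->
    x + s + p \in b.
  move=> /hs; rewrite -addrA !inE => /or3P[] /eqP ->.
  - by rewrite addr0.
  - by rewrite addrC subrK.
  - exact: (plane_line hB).
move=> z; rewrite !inE -{1}[x + s]addr0 => /or3P[] /eqP ->;
by apply: hs; rewrite !inE eqxx ?orbT.
Qed.

Lemma translate_of_col b b' c : b \in Bk -> b' \in Bk ->
  has_col b c -> has_col b' c -> exists k, b' = translate b k.
Proof.
move=> bB b'B /(col_point bB)[t /repzP[_ n0 _] tb] /(col_point b'B)[t' _ tb'].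
exists (t' - t); apply: (translate_eq bB b'B n0).
- by apply: tb; rewrite !inE eqxx.
- by apply: tb; rewrite !inE eqxx orbT.
- by apply: tb'; rewrite !inE eqxx.
- by apply: tb'; rewrite !inE eqxx orbT.
Qed.

Definition stab_free (b : {set 'Z_n511}) := forall s, translate b s = b -> s = 0.

Lemma cod_multiples s n :
  traject (addc (cod s)) code0 n = map cod (traject (+%R s) 0 n).
Proof.
rewrite -cod0; elim: n 0 => //= n IHn x.
by rewrite -codD IHn.
Qed.

Lemma uniq3E s : uniq3 s = uniq s.
Proof. by elim: s => //= e s ->; rewrite has_eq3. Qed.

(** The points [x + i s] lie in [b]. More than seven are impossible, so they are seven, exhaust [b],
    and have differences that the check places in [gf8_col]. *)
Lemma stabilizer_gf8 b s x y : b \in Bk -> s != 0 -> translate b s = b ->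
  x \in b -> y \in b -> x != y -> colz (y - x) = gf8_col.
Proof.
move=> bB ns sb xb yb nxy.
have orb_b n : {subset [seq x + v | v <- traject (+%R s) 0 n] <= b}.
  have step z : z \in b -> z + s \in b by rewrite -{2}sb mem_translate addrK.
  move=> _ /mapP[v + ->]; have: x + 0 \in b by rewrite addr0.
  elim: n 0 => //= n IHn z xz; rewrite inE => /predU1P[-> //|].
  by apply: IHn; rewrite [s + z]addrC addrA step.
have card_le n : uniq (traject (addc (cod s)) code0 n) -> (n <= #|b|)%N /\
    uniq [seq x + v | v <- traject (+%R s) 0 n].
  rewrite cod_multiples (map_inj_uniq cod_inj) => Un.
  have U : uniq [seq x + v | v <- traject (+%R s) 0 n].
    by rewrite (map_inj_uniq (addrI x)).
  split=> //; rewrite -(size_traject (+%R s) 0 n) -(size_map (+%R x)).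
  by rewrite -(card_uniqP U); apply/subset_leq_card/subsetP/orb_b.
have := allP stabilizer_checkT _ (cod_nonzero ns); rewrite /stabilizer_check !uniq3E.
case/orP=> [/card_le[]|]; first by rewrite (plane_card hB bB).
case/andP=> /card_le[_ U]; rewrite cod_multiples => /allP h.
have b7 : [seq x + v | v <- traject (+%R s) 0 7] =i b.
  apply/subset_cardP; last by apply/subsetP/orb_b.
  by rewrite (card_uniqP U) (plane_card hB bB).
move: (xb) (yb) nxy; rewrite -!b7 => /mapP[p ps ex] /mapP[q qs ey] nxy.
have -> : y - x = q - p by rewrite ey {2}ex; ring.
move: (h _ (map_f cod ps)) => /allP/(_ _ (map_f cod qs)).
rewrite eq3E eq2E (inj_eq cod_inj) -codB => /orP[/eqP epq|/eqP //].
by case/eqP: nxy; rewrite ex ey epq.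
Qed.

Definition diff_set (b : {set 'Z_n511}) : {set 'Z_n511} :=
  [set p.2 - p.1 | p in [set p in setX b b | p.1 != p.2]].

Lemma diff_setP (b : {set 'Z_n511}) (d : 'Z_n511) :
  reflect (exists x y, [/\ x \in b, y \in b, x != y & d = y - x])
  (d \in diff_set b).
Proof.
apply: (iffP imsetP) => [[[x y]]|[x [y [xb yb nxy ->]]]].
  by rewrite !inE /= => /andP[/andP[xb yb] nxy] ->; exists x, y.
by exists (x, y); rewrite // !inE xb yb.
Qed.

(** Of the 7 * 6 ordered pairs of distinct points, two with equal difference would give a
    translation fixing [b], which is trivial by hypothesis. *)
Lemma card_diff_set b : b \in Bk -> stab_free b -> #|diff_set b| = 42%N.
Proof.
move=> bB free; rewrite card_in_imset; last first.
  move=> [x y] [x' y']; rewrite !inE /= => /andP[/andP[xb yb] nxy].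
  move=> /andP[/andP[xb' yb'] _] e.
  have /free/eqP : translate b (x' - x) = b.
    apply/esym/(translate_eq bB bB (d := y - x)) => //.
    - by rewrite subr_eq0 eq_sym.
    - by rewrite addrC subrK.
    - by rewrite e addrC subrK.
  rewrite subr_eq0 => /eqP ex; rewrite ex; congr (_, _).
  by move: e; rewrite ex => /addIr.
have -> : [set p in setX b b | p.1 != p.2] =
    setX b b :\: [set (x, x) | x in b].
  apply/setP => -[x y]; rewrite !inE /= andbC.
  have [xb|_] /= := boolP (x \in b); last by rewrite !andbF.
  have [yb|_] /= := boolP (y \in b); last by rewrite !andbF.
  rewrite !andbT; congr (~~ _); apply/eqP/imsetP => [<-|[z _ [-> ->]]] //.
  by exists x.
rewrite cardsD cardsX (setIidPr _).
  by rewrite card_imset ?(plane_card hB bB) // => x y [].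
by apply/subsetP => _ /imsetP[x xb ->]; rewrite inE /= xb.
Qed.

Lemma diff_set_translate b k : diff_set (translate b k) = diff_set b.
Proof.
apply/setP => d; apply/diff_setP/diff_setP => -[x [y [xb yb nxy ->]]].
  exists (x - k), (y - k); rewrite -!mem_translate; split=> //.
    by rewrite (inj_eq (addIr _)).
  by ring.
exists (x + k), (y + k); rewrite !mem_translate !addrK; split=> //.
  by rewrite (inj_eq (addIr _)).
by ring.
Qed.

(* Otherwise the difference sets of the planes would partition the 510 nonzero
   residues into sets of size 42. *)
Lemma exists_stabilized : exists b s, [/\ b \in Bk, s != 0 & translate b s = b].
Proof.
have [/existsP[b /existsP[s /and3P[bB ns /eqP sb]]]|none] :=
  boolP [exists b, exists s, [&& b \in Bk, s != 0 & translate b s == b]].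
  by exists b, s.
have free b : b \in Bk -> stab_free b.
  move=> bB s sb; apply/eqP; apply: contraNT none => ns.
  by apply/existsP; exists b; apply/existsP; exists s; rewrite bB ns sb /=.
pose P := diff_set @: Bk.
have partP : partition P [set~ 0].
  apply/and3P; split.
  - apply/eqP/setP => d; rewrite !inE; apply/bigcupP/idP.
      move=> [_ /imsetP[b _ ->] /diff_setP[x [y [_ _ nxy ->]]]].
      by rewrite subr_eq0 eq_sym.
    rewrite eq_sym => nd; have [b bB [ob db]] := plane_ex hB nd.
    exists (diff_set b); first exact: imset_f.
    by apply/diff_setP; exists 0, d; rewrite subr0.
  - apply/trivIsetP => _ _ /imsetP[b bB ->] /imsetP[b' b'B ->].
    apply: contraNT => /pred0Pn[d /andP[/diff_setP[x [y [xb yb nxy ed]]]]].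
    move=> /diff_setP[x' [y' [xb' yb' _ ed']]].
    suff -> : b' = translate b (x' - x) by rewrite diff_set_translate.
    apply: (translate_eq bB b'B (d := d)) => //.
    + by rewrite ed subr_eq0 eq_sym.
    + by rewrite ed addrC subrK.
    + by rewrite ed' addrC subrK.
  - apply/imsetP => -[b bB /esym/eqP].
    by rewrite -cards_eq0 (card_diff_set bB) //; exact: free.
have: #|[set~ (0 : 'Z_n511)]| = (#|P| * 42)%N.
  apply: card_uniform_partition partP => _ /imsetP[b bB ->].
  by rewrite card_diff_set //; exact: free.
(* 510 leaves remainder 6 modulo 42. *)
by rewrite cardsC1 card_ord => /(congr1 (modn^~ 42)); rewrite modnMl.
Qed.

(** All planes with column [gf8_col] are translates of one stabilized plane, and a stabilized plane
    has no other column. *)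
Lemma col_not_gf8 b c : b \in Bk -> c \in columns -> has_col b c ->
  ~ has_col b gf8_col /\ stab_free b.
Proof.
move=> bB cC bc; have ngc : c <> gf8_col by move=> e; move: cC; rewrite e.
have no_stab b' s : b' \in Bk -> s != 0 -> translate b' s = b' -> ~ has_col b' c.
  move=> bB' ns sb [x [y [xb yb nxy e]]].
  by apply: ngc; rewrite -e; apply: stabilizer_gf8 sb xb yb nxy.
split=> [bg|s sb]; last first.
  by apply/eqP; apply/negPn/negP => ns; apply: (no_stab b s).
have [b' [s [bB' ns sb]]] := exists_stabilized.
have [] // : exists k, b = translate b' k.
  apply: (translate_of_col bB' bB (c := gf8_col)) => //.
  have /card_gt1P[x [y [xb yb nxy]]] : (1 < #|b'|)%N by rewrite (plane_card hB bB').
  by exists x, y; split=> //; apply: stabilizer_gf8 sb xb yb nxy.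
by move=> k e; apply: (no_stab b' s) => //; rewrite -(has_col_translate b' k) -e.
Qed.

Lemma undup2E s : undup2 s = undup s.
Proof. by elim: s => //= c s ->; rewrite has_eq2. Qed.

Lemma differences_uniq (l : seq 'Z_n511) :
  code0 \notin differences (map cod l) -> uniq l.
Proof.
elim: l => //= x l IHl; rewrite mem_cat negb_or => /andP[h /IHl ->].
rewrite andbT; apply: contra h => xl; apply/mapP; exists (cod x).
  exact: map_f.
by rewrite -codB subrr.
Qed.

Lemma mem_differences (l : seq 'Z_n511) x y : x \in l -> y \in l -> x != y ->
  cod (y - x) \in differences (map cod l) \/
  cod (x - y) \in differences (map cod l).
Proof.
elim: l => //= z l IHl; rewrite !inE !mem_cat.
move=> /predU1P[->|xl] /predU1P[->|yl] nxy.
- by rewrite eqxx in nxy.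
- by left; rewrite codB (map_f (subc^~ (cod z))) ?map_f.
- by right; rewrite codB (map_f (subc^~ (cod z))) ?map_f.
- by have [->|->] := IHl xl yl nxy; rewrite !orbT; [left|right].
Qed.

Lemma differences_mem (l : seq 'Z_n511) e : uniq l ->
  e \in differences (map cod l) ->
  exists x y, [/\ x \in l, y \in l, x != y & e = cod (y - x)].
Proof.
elim: l => //= z l IHl /andP[zl Ul]; rewrite mem_cat => /orP[|/(IHl Ul)].
  rewrite -map_comp => /mapP[y yl ->]; exists z, y.
  by rewrite !inE eqxx yl orbT codB; split=> //; apply: contraNneq zl => ->.
by move=> [x [y [xl yl nxy ->]]]; exists x, y; rewrite !inE xl yl !orbT.
Qed.

Lemma colz0 : line_col code0 = no_col.
Proof. by vm_compute. Qed.

(** Translate [b] so that it contains the base line of [c]. Absence of [no_col] makes the seven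
    entries of [plane] distinct, and then they exhaust the translate. *)
Lemma plane_cols b c : b \in Bk -> c \in columns -> has_col b c ->
  exists2 j, j \notin [:: 0; repz c; zechz (repz c)] &
    let cs := map line_col (differences (plane (rep c) (cod j))) in
    no_col \notin cs -> forall c', has_col b c' <-> c' \in cs.
Proof.
move=> bB cC bc; have cA : c \in all_cols by rewrite inE cC orbT.
have [er nr colr] := repzP cA.
have [t _ tb] := col_point bB bc; set r := repz c in er nr colr tb *.
set w := zechz r in tb *; pose b1 := translate b (- t).
have b1B : b1 \in Bk by exact: translate_plane.
have lineb1 : {subset [:: 0; r; w] <= b1}.
  move=> p; rewrite !inE mem_translate opprK => /or3P[] /eqP->; apply: tb;
  by rewrite !inE ?add0r -1?[_ + t]addrC ?eqxx ?orbT.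
have [j jb1 jl] : exists2 j, j \in b1 & j \notin [:: 0; r; w].
  (* Seven points do not fit into three; [leqnn 4] merely offers a true statement whose negation
     computes to [false], as [7 <= 3] does. *)
  apply/subsetPn; apply: contraTN (leqnn 4) => /subset_leq_card.
  rewrite (plane_card hB b1B) => h; rewrite -ltnNge.
  by have := leq_trans h (card_size _).
exists j => // cs ncs.
have [nj0 njr njw] : [/\ j != 0, j != r & j != w].
  by move: jl; rewrite !inE !negb_or => /and3P[].
pose l := [:: 0; r; w; j; zechz j; r + zechz (j - r); w + zechz (j - w)].
have el : map cod l = plane (rep c) (cod j).
  rewrite /plane -er -cod_zechz // -/w -!codB -!cod_zechz ?subr_eq0 //.
  by rewrite -!codD.
have Ul : uniq l.
  apply: differences_uniq; rewrite el; apply: contra ncs => h.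
  by rewrite -colz0 map_f.
have lb1 : l =i b1.
  apply/subset_cardP; first by rewrite (card_uniqP Ul) (plane_card hB b1B).
  have line x y := plane_line hB b1B (x := x) (y := y).
  have [b0 br bw] : [/\ 0 \in b1, r \in b1 & w \in b1].
    by split; apply: lineb1; rewrite !inE eqxx ?orbT.
  apply/subsetP => p; rewrite !inE => /or4P[/eqP->|/eqP->|/eqP->|] //.
  case/or4P => /eqP-> //.
  - by rewrite -[zechz j]add0r -{1}[j]subr0 line // eq_sym.
  - by rewrite line // eq_sym.
  - by rewrite line // eq_sym.
move=> c'; rewrite -(has_col_translate b (- t)) -/b1 /cs -el; split.
  move=> [x [y [xb yb nxy <-]]]; rewrite -!lb1 in xb yb.
  have [h|h] := mem_differences xb yb nxy; first exact: (map_f line_col h).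
  by rewrite -colzN ?subr_eq0 1?eq_sym // opprB; exact: (map_f line_col h).
move=> /mapP[e /(differences_mem Ul)[x [y [xl yl nxy ->]]] ->].
by exists x, y; rewrite -!lb1.
Qed.

Lemma size_col_diffs u :
  size (flatten [seq col_diffs c | c <- u]) = (6 * size u)%N.
Proof. by elim: u => //= c u IHu; rewrite /col_diffs get_tab2 /= IHu; lia. Qed.

(** Each column accounts for at most 6 of the 42 differences, so at least 7 columns occur. The check
    yields a listed 7-set containing them all, hence equal to them. *)
Lemma plane_id b c : b \in Bk -> c \in columns -> has_col b c ->
  exists2 i, i \in ids & forall c', has_col b c' <-> c' \in cols i.
Proof.
move=> bB cC bc; have [ngf free] := col_not_gf8 bB cC bc.
have cA : c \in all_cols by rewrite inE cC orbT.
have [er nr colr] := repzP cA.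
have [j jl] := plane_cols bB cC bc.
set cs := map line_col _ => /= csP.
have cs7 : no_col \notin cs -> (7 <= size (undup cs))%N.
  move=> /csP {}csP; have := card_diff_set bB free.
  pose s := flatten [seq col_diffs c | c <- undup cs].
  have sub : {subset map cod (enum (diff_set b)) <= s}.
    move=> _ /mapP[d + ->]; rewrite mem_enum => /diff_setP[x [y [xb yb nxy ->]]].
    have nd : y - x != 0 by rewrite subr_eq0 eq_sym.
    apply/flattenP; exists (col_diffs (colz (y - x))); last exact: col_diffsP.
    by apply: map_f; rewrite mem_undup; apply/csP; exists x, y.
  have := uniq_leq_size _ sub; rewrite (map_inj_uniq cod_inj) enum_uniq size_map.
  move=> /(_ isT); rewrite -cardE => h e; move: h; rewrite e.
  by rewrite size_col_diffs (leq_pmul2l (isT : 0 < 6)%N : (6 * 7 <= _)%N = _).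
have := allP col_checkT c cC; rewrite /col_check => /allP/(_ _ (cod_codes j)).
have -> : [:: code0; rep c; zech (rep c)] =
  map cod [:: 0; repz c; zechz (repz c)] by rewrite /= cod_zechz // er.
rewrite has_eq3 (mem_map cod_inj) (negPf jl) /= /plane_check -/cs => /orP[|]; last first.
  rewrite !has_eq2 undup2E => /andP[nc /orP[gf|lt7]].
    by case: ngf; apply/(csP nc).
  by move: lt7; rewrite ltnNge cs7.
rewrite get_tab2 => /hasP[i].
rewrite mem_filter /col_ids get_tab2 mem_filter => /and3P[_ _ iI] /allP hi.
have {}hi c' : c' \in cs -> c' \in cols i by move=> /hi; rewrite hitE.
have /andP[/andP[_ /allP iC] /eqP i7] := allP ids_checkT i iI.
have nc : no_col \notin cs.
  by apply/negP => /hi/iC; rewrite has_eq2.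
exists i => // c'; rewrite (csP nc).
have sub : {subset undup cs <= cols i} by move=> d; rewrite mem_undup; apply: hi.
have [//|_ e] := uniq_min_size (undup_uniq cs) sub; first by rewrite i7 cs7.
by rewrite -e mem_undup.
Qed.

Lemma ids_inj i j : i \in ids -> j \in ids -> cols i =i cols j -> i = j.
Proof.
move=> iI jI e; have /andP[/andP[/allP h _] /eqP i7] := allP ids_checkT i iI.
have hj : j \in col_ids (head no_col (cols i)).
  rewrite /col_ids get_tab2 mem_filter jI andbT -surjective_pairing hitE -e.
  by case: (cols i) i7 => // c s _; rewrite mem_head.
move: (h j hj) => /implyP; rewrite eq3E => hij; apply/eqP/hij/allP => c.
by rewrite e hitE.
Qed.

(** Planes sharing a column are translates, so they have the same columns, and [ids_inj] identifies
    their sets. *)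
Lemma cyclic_planes_cover : exists X, exact_cover X.
Proof.
exists (fun i => i \in ids /\
  exists2 b, b \in Bk & forall c, has_col b c <-> c \in cols i).
split=> [i []//|c cC|i j c [iI [b bB bi]] [jI [b' bB' bj]] ci cj].
  have cA : c \in all_cols by rewrite inE cC orbT.
  have [er nr colr] := repzP cA.
  have [b bB [ob rb]] : exists2 b, b \in Bk & 0 \in b /\ repz c \in b.
    by apply: (plane_ex hB); rewrite eq_sym.
  have bc : has_col b c.
    by exists 0, (repz c); rewrite subr0 eq_sym.
  have [i iI bi] := plane_id bB cC bc.
  by exists i; [split=> //; exists b | apply/bi].
have [k e] := translate_of_col bB bB' (proj2 (bi c) ci) (proj2 (bj c) cj).
rewrite {}e in bj.
apply: ids_inj => // d; apply/idP/idP.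
  by move=> /bi/(has_col_translate b k)/bj.
by move=> /bj/(has_col_translate b k)/bi.
Qed.
End CyclicPlanes.

(** * Exponents with respect to a Singer matrix *)

(* x ^ 9 + x ^ 4 + 1 is primitive over F_2; [mulx] is multiplication by x modulo
   this polynomial on coefficient lists. *)
Definition fpoly : {poly 'F_2} := 'X^9 + 'X^4 + 1.

Definition eval_bits (s : seq bool) : {poly 'F_2} :=
  foldr (fun (b : bool) p => b%:R + 'X * p) 0 s.

Lemma char2_poly : (2%:R : {poly 'F_2}) = 0.
Proof.
by rewrite -(rmorph_nat (@polyC 'F_2)) (_ : 2%:R = 0) //; apply: val_inj.
Qed.

Lemma eval_mulx s : size s = 9%N -> exists b : bool,
  'X * eval_bits s = eval_bits (mulx s) + b%:R * fpoly.
Proof.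
case: s => [|b0 [|b1 [|b2 [|b3 [|b4 [|b5 [|b6 [|b7 [|b8 []]]]]]]]]] // _.
(* [ring] does not use [2 = 0]; the added multiple of 2 is the difference of the two sides over the
   integers. *)
exists b8; rewrite -[LHS]addr0 -(mul0r (b8%:R * (1 + (~~ b3)%:R * 'X^4))).
rewrite -char2_poly /eval_bits /fpoly.
by case: b8; case: b3 => /=; ring.
Qed.

Lemma eval_add1 s : (0 < size s)%N -> eval_bits (add1 s) = 1 + eval_bits s.
Proof.
case: s => // b s _ /=; rewrite addrA; congr (_ + _).
by case: b; rewrite /= ?addr0 // -[LHS]char2_poly mulr2n.
Qed.

Definition pow (n : nat) : seq bool := iter n mulx (true :: nseq 8 false).

Lemma size_pow n : size (pow n) = 9%N.
Proof.
elim: n => //= n; rewrite -/(pow n).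
by case: (pow n) => [|? [|? [|? [|? [|? [|? [|? [|? [|? []]]]]]]]]].
Qed.

Lemma nth_powers n : (n < 511)%N -> nth [::] powers n = pow n.
Proof.
by move=> ltn; rewrite (set_nth_default (pow 0)) ?size_traject // nth_traject.
Qed.

Lemma add1_pow n : (0 < n)%N -> (n < 511)%N -> add1 (pow n) \in powers.
Proof.
case: n => // n _ ltn.
have /allP : all (fun s => add1 s \in powers) (behead powers) by vm_compute.
apply; rewrite -(nth_powers ltn) -nth_behead; apply: mem_nth.
by rewrite size_behead size_traject; exact: ltn.
Qed.

(** * Powers of a matrix root of [fpoly] *)

Section Root.

Variables (n' : nat) (M : 'M['F_2]_n'.+1).
Hypothesis fM : horner_mx M fpoly = 0.

Lemma root_pow n : M ^+ n = horner_mx M (eval_bits (pow n)).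
Proof.
elim: n => [|n IHn]; first by rewrite /eval_bits /= !(addr0, mulr0) rmorph1.
have [b e] := eval_mulx (size_pow n).
have := congr1 (horner_mx M) e; rewrite rmorphM rmorphD rmorphM /= fM mulr0 addr0.
by rewrite horner_mx_X -IHn -exprS => ->.
Qed.

Lemma root_order : M ^+ 511 = 1.
Proof.
rewrite root_pow (_ : pow 511 = pow 0); last by vm_compute.
by rewrite -root_pow.
Qed.

Lemma root_zech (x : 'Z_n511) : x != 0 -> 1 + M ^+ x = M ^+ zechz x.
Proof.
move=> nx; have [_ ex] := code_ofK (ltn_ord x).
have x_gt0 : (0 < x)%N by rewrite lt0n.
have memp := add1_pow x_gt0 (ltn_ord x).
have := memp; rewrite -index_mem size_traject => idx.
have -> : zechz x = index (add1 (pow x)) powers :> nat.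
  have [_ e] := code_ofK idx.
  rewrite /zechz /zech get_tab3 [nat_of (cod x)]ex nth_powers //.
  rewrite [LHS](_ : _ =
    nat_of (code_of (index (add1 (pow x)) powers)) %% 511)%N //.
  by rewrite e modn_small.
have ei : pow (index (add1 (pow x)) powers) = add1 (pow x).
  by rewrite -nth_powers // nth_index.
by rewrite [RHS]root_pow ei eval_add1 ?size_pow // rmorphD rmorph1 root_pow.
Qed.

End Root.

Lemma eval_pow n : exists g, 'X^n = eval_bits (pow n) + g * fpoly.
Proof.
elim: n => [|n [g IHn]].
  by exists 0; rewrite /eval_bits /= !(addr0, mulr0, mul0r).
have [b e] := eval_mulx (size_pow n); exists (b%:R + 'X * g).
by rewrite exprS IHn mulrDr e -[pow n.+1]/(mulx (pow n)); ring.
Qed.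

(** Since [pow 511] is again [pow 0], [fpoly] divides [X ^ 511 - 1]. *)
Lemma fpoly_dvd : exists g, 'X^512 - 'X = g * fpoly.
Proof.
have [g e] := eval_pow 511; exists ('X * g).
have {e} e : 'X^511 = 1 + g * fpoly.
  rewrite e (_ : pow 511 = pow 0); last by vm_compute.
  by rewrite /eval_bits /= !(addr0, mulr0).
by rewrite exprS e; ring.
Qed.

Lemma size_fpoly : size fpoly = 10%N.
Proof.
rewrite /fpoly -addrA size_polyDl size_polyXn //.
by rewrite (leq_ltn_trans (size_polyD _ _)) // size_polyXn size_poly1.
Qed.

(** Over a noncommutative ring the bound on the number of roots asks for commuting roots with
    invertible differences. *)
Lemma uniq_rootsP (R : unitRingType) (rs : seq R) :
  uniq rs -> {in rs &, forall x y, x * y = y * x} ->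
  {in rs &, forall x y, x != y -> y - x \is a GRing.unit} -> uniq_roots rs.
Proof.
elim: rs => //= x rs IHrs /andP[xrs Urs] comm unit; apply/andP; split.
  apply/allP => y yrs; apply/andP; split.
    by apply/eqP/comm; rewrite inE ?eqxx ?yrs ?orbT.
  by apply: unit; rewrite ?inE ?eqxx ?yrs ?orbT //; apply: contraNneq xrs => ->.
by apply: IHrs => // y z yrs zrs; [apply: comm | apply: unit];
  rewrite inE ?yrs ?zrs orbT.
Qed.

(** * A root of [fpoly] in the field generated by a Singer matrix *)

Section Singer.

Variables (n' : nat) (A : 'M['F_2]_n'.+1).
Hypothesis unitA : A \is a GRing.unit.
Hypothesis orderA : A ^+ 511 = 1.
Hypothesis freeA : forall d, (0 < d < 511)%N -> A ^+ d <> 1.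
Hypothesis fieldA : forall N, comm_mx A N -> N <> 0 -> exists i, N = A ^+ i.

Lemma singer_unit N : comm_mx A N -> N <> 0 -> N \is a GRing.unit.
Proof. by move=> cN /(fieldA cN)[i ->]; rewrite unitrX. Qed.

(* The 512 elements 0, A ^ i are roots of X ^ 512 - X = g * f, but g has at most
   503 roots. *)
Lemma singer_root : exists2 M, comm_mx A M & horner_mx M fpoly = 0.
Proof.
have [g eg] := fpoly_dvd; pose rs := 0 :: [seq A ^+ i | i <- iota 0 511].
have A_inj i j : (i < j < 511)%N -> A ^+ i <> A ^+ j.
  move=> /andP[ltij ltj] e; apply: (@freeA (j - i)%N); first by lia.
  apply: (mulrI (unitrX i unitA)); rewrite mulr1 -exprD subnKC //.
  exact: ltnW.
have Urs : uniq rs.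
  rewrite cons_uniq map_inj_in_uniq ?iota_uniq ?andbT.
    apply/negP => /mapP[i _ /esym e]; have := unitrX i unitA.
    by rewrite e unitr0.
  move=> i j; rewrite !mem_iota !add0n => /andP[_ li] /andP[_ lj] e.
  have [ltij|ltji|//] := ltngtP i j.
    by case: (@A_inj i j); rewrite ?ltij.
  by case: (@A_inj j i); rewrite ?ltji.
have rsA N : N \in rs -> comm_mx A N /\ N ^+ 512 = N.
  rewrite inE => /predU1P[->|/mapP[i _ ->]].
    by split; [rewrite /comm_mx mulmx0 mul0mx | rewrite expr0n].
  split; first by rewrite /comm_mx; apply/commrX.
  by rewrite exprS -exprM mulnC exprM orderA expr1n mulr1.
have commA N N' : N \in rs -> N' \in rs -> N * N' = N' * N.
  rewrite inE => /predU1P[->|/mapP[i _ ->]]; first by rewrite mulr0 mul0r.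
  rewrite inE => /predU1P[->|/mapP[j _ ->]]; first by rewrite mulr0 mul0r.
  by rewrite -!exprD addnC.
have [/hasP[M Mrs /eqP fM]|/hasPn none] :=
  boolP (has (fun N => horner_mx N fpoly == 0) rs).
  by exists M => //; case: (rsA M Mrs).
(* The degree is 512 - 9 = 503, and [size] is one more. *)
have size_g : size g = 504%N.
  have g0 : g != 0.
    apply: contra_eqN eg => /eqP ->; rewrite mul0r subr_eq0.
    apply/eqP => /(congr1 (fun p : {poly 'F_2} => size p)).
    by rewrite size_polyXn size_polyX.
  have f0 : fpoly != 0 by rewrite -size_poly_gt0 size_fpoly.
  have := size_mul g0 f0; rewrite -eg size_fpoly size_polyDl size_polyXn.
    by rewrite addnS => /eqP; rewrite (eqn_add2r 9 504) => /eqP.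
  by rewrite size_polyN size_polyX.
have := @max_ring_poly_roots _ (map_poly scalar_mx g) rs.
rewrite map_poly_eq0 -size_poly_gt0 size_map_poly size_g.
rewrite (_ : size rs = (size [seq A ^+ i | i <- iota 0 511]).+1) //.
rewrite size_map size_iota.
suff: all (root (map_poly scalar_mx g)) rs && uniq_roots rs.
  by move=> /andP[-> ->] /(_ isT isT isT).
apply/andP; split; last first.
  apply: uniq_rootsP => // N N' NR N'R ne; apply: singer_unit.
    by apply: comm_mxB; [case: (rsA _ N'R) | case: (rsA _ NR)].
  by apply/eqP; rewrite subr_eq0 eq_sym.
apply/allP => N NR; have [cN N512] := rsA N NR.
(* The value of [fpoly] at [N] is nonzero by [none] and commutes with [A]; being invertible, it
   cancels from the product that vanishes at [N]. *)
have /unitrP[V [_ fV]] : horner_mx N fpoly \is a GRing.unit.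
  by apply: singer_unit; [exact: comm_mx_horner | exact/eqP/none].
have : horner_mx N ('X^512 - 'X) = 0.
  by rewrite rmorphB rmorphXn /= horner_mx_X N512 subrr.
rewrite eg rmorphM /= => /(congr1 ( *%R^~ V)); rewrite -mulrA fV mulr1 mul0r.
by move=> gN; apply/eqP.
Qed.
End Singer.

Lemma F2_mx_eq n (N N' : 'M['F_2]_n) :
  (forall u : 'rV_n, u != 0 -> u *m N = u *m N') -> N = N'.
Proof.
move=> e; apply/row_matrixP => i; rewrite !rowE.
have [->|] := eqVneq (delta_mx 0 i : 'rV['F_2]_n) 0; first by rewrite !mul0mx.
exact: e.
Qed.

Lemma mulmx_unit_neq0 n (N : 'M['F_2]_n.+1) (u : 'rV_n.+1) :
  N \is a GRing.unit -> u != 0 -> u *m N != 0.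
Proof.
by move=> uN; apply: contraNneq => e; rewrite -(mulmxK uN u) e mul0mx.
Qed.

Lemma pointP n (u : 'rV['F_2]_n) : u != 0 -> {x : point n | val x = u}.
Proof. by move=> nu; exists (exist _ u nu). Qed.

(** * From a cyclic design to planes of exponents *)

Section CyclicDesign.

Variable (B : {set {set point 9}}).
Hypotheses (design_B : is_two_analog 3 B) (cyclic_B : is_cyclic B).

(** For the last property of [A], choose [v] with [v N] nonzero. By transitivity [v N = v A ^ i] for
    some [i], and every point is some [v A ^ j]; as [N] commutes with [A], it agrees with [A ^ i] on
    all points. *)
Lemma singer_matrix : exists2 A : 'M['F_2]_9,
  [/\ A \is a GRing.unit, A ^+ 511 = 1,
      forall d, (0 < d < 511)%N -> A ^+ d <> 1 &
      forall N, comm_mx A N -> N <> 0 -> exists i, N = A ^+ i] &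
  forall b, b \in B -> exists2 b', b' \in B &
    forall x y : point 9, val y = val x *m A -> (y \in b') = (x \in b).
Proof.
have [[cardT _ _] _] := design_B; have [s [sP sB] orbs] := cyclic_B.
move: sP; rewrite inE => /existsP[A /andP[uA /forallP sA]].
have {}sA x : val (s x) = val x *m A by apply/eqP.
have siter i x : val ((s ^+ i)%g x) = val x *m A ^+ i.
  elim: i => [|i IHi]; first by rewrite perm1 mulmx1.
  by rewrite expgSr permM sA IHi exprSr mulmxA.
have orb x : porbit s x = [set: point 9].
  by apply/set1P; rewrite -orbs; apply: imset_f.
have orb_card x : #|porbit s x| = 511%N by rewrite orb cardsT cardT.
have [x0 _] : exists x0 : point 9, x0 \in [set: point 9].
  by apply/set0Pn; rewrite -card_gt0 cardsT cardT.
exists A; last first.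
  move=> b bB; exists (s @: b); first by rewrite -sB imset_f.
  move=> x y e; rewrite -(_ : s x = y) ?(mem_imset _ _ perm_inj) //.
  by apply: val_inj; rewrite sA e.
split=> //.
- apply: F2_mx_eq => _ /pointP[x <-]; rewrite mulmx1 -siter permX.
  by rewrite -[in iter _](orb_card x) iter_porbit.
- move=> d /andP[d_gt0 ltd] e; have := uniq_traject_porbit s x0.
  rewrite orb_card => /(uniqP x0) /(_ 0 d); rewrite !inE size_traject => /(_ isT ltd).
  have ed : iter d s x0 = x0.
    by rewrite -permX; apply: val_inj; rewrite siter e mulmx1.
  by rewrite !nth_traject // ed => /(_ erefl) d0; rewrite -d0 in d_gt0.
move=> N cN /eqP nN.
have [v v0 vN] : exists2 v : 'rV['F_2]_9, v != 0 & v *m N != 0.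
  have [v /andP[v0 vN]|none] :=
    pickP [pred v : 'rV['F_2]_9 | (v != 0) && (v *m N != 0)].
    by exists v.
  case/eqP: nN; apply: F2_mx_eq => u u0; rewrite mulmx0; apply/eqP.
  by have := none u; rewrite /= u0 => /negbFE.
have [x ex] := pointP v0; have [y ey] := pointP vN.
have /porbitP[i ei] : y \in porbit s x by rewrite orb inE.
exists i; apply: F2_mx_eq => _ /pointP[z <-].
have /porbitP[j ->] : z \in porbit s x by rewrite orb inE.
have cNj : A ^+ j * N = N * A ^+ j by apply/esym/commrX/esym.
rewrite siter -!mulmxA [A ^+ j *m N]cNj [A ^+ j *m A ^+ i](_ : _ = A ^+ i * A ^+ j).
  by rewrite !mulmxA ex -ey ei siter ex.
by rewrite -exprD addnC exprD.
Qed.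

(** The root [M] is a power of [A] and so preserves the blocks; exponent [k] stands for the point
    [x0 M ^ k]. *)
Lemma cyclic_planes_of_design : exists Bk, cyclic_planes Bk.
Proof.
have [[cardT cardb pairB] subB] := design_B.
have [A [uA oA frA fdA] AB] := singer_matrix.
have [M cM fM] := singer_root uA oA frA fdA.
have M0 : M <> 0.
  move=> e; move: fM; rewrite e /fpoly !rmorphD /= !rmorphXn /= horner_mx_X rmorph1.
  by rewrite !expr0n /= !add0r; apply/eqP/oner_neq0.
have uM := singer_unit uA fdA cM M0.
have MB b : b \in B -> exists2 b', b' \in B &
    forall x y : point 9, val y = val x *m M -> (y \in b') = (x \in b).
  have [j ->] := fdA M cM M0; elim: j => [|j IHj] bB.
    by exists b => // x y; rewrite mulmx1 => /val_inj ->.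
  have [b1 b1B h1] := IHj bB; have [b2 b2B h2] := AB b1 b1B.
  exists b2 => // x y; rewrite exprSr mulmxA => e.
  have [z ez] := pointP (mulmx_unit_neq0 (unitrX j uA) (valP x)).
  by rewrite (h2 z y) ?(h1 x z) ?ez.
have oM := root_order fM.
have powM (x : nat) : M ^+ (x %% 511) = M ^+ x by apply: expr_mod.
have [x0 _] : exists x0 : point 9, x0 \in [set: point 9].
  by apply/set0Pn; rewrite -card_gt0 cardsT cardT.
pose P (k : 'Z_n511) : point 9 :=
  sval (pointP (mulmx_unit_neq0 (unitrX k uM) (valP x0))).
have valPE k : val (P k) = val x0 *m M ^+ k by rewrite /P; case: pointP.
have PD k (d : 'Z_n511) : val (P (k + d)) = val (P k) *m M ^+ d.
  by rewrite !valPE -mulmxA -[_ *m M ^+ d]exprD -[in RHS]powM.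
have P_line (x y : 'Z_n511) :
    x != y -> val (P (x + zechz (y - x))) = val (P x) + val (P y).
  move=> nxy; rewrite -[in RHS](subrK x y) [y - x + x]addrC !PD -root_zech //.
    by rewrite mulmxDr mulmx1.
  by rewrite subr_eq0 eq_sym.
(* Equal points at distinct exponents would make the third point of their line the zero vector. *)
have injP : injective P.
  move=> x y e; apply/eqP; apply: contraT => /P_line; rewrite e => e0.
  have := valP (P (x + zechz (y - x))); rewrite e0.
  rewrite -mulr2n -scaler_nat (_ : 2%:R = 0 :> 'F_2) ?scale0r ?eqxx //.
  exact: val_inj.
have [Q PK QK] : bijective P.
  by apply: inj_card_bij injP _; rewrite cardT card_ord.
exists [set P @^-1: b | b : {set point 9} in B]; split.
- move=> _ /imsetP[b bB ->]; rewrite on_card_preimset; first exact: cardb.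
  by exists Q; move=> ? _.
- move=> x y nxy; have [|b [[bB xb yb] _]] := pairB (P x) (P y).
    by rewrite (inj_eq injP).
  by exists (P @^-1: b); rewrite ?imset_f // !inE.
- move=> _ _ x y /imsetP[b bB ->] /imsetP[b' bB' ->] nxy.
  rewrite !inE => xb yb xb' yb'.
  have [|b0 [_ u]] := pairB (P x) (P y); first by rewrite (inj_eq injP).
  have <- : b0 = b by apply: u.
  by have <- : b0 = b' by apply: u.
- move=> _ x y /imsetP[b bB ->]; rewrite !inE => xb yb nxy.
  have [U _ eU] := subB b bB; move: xb yb; rewrite eU !inE P_line // => xU yU.
  exact: memvD.
move=> _ /imsetP[b bB ->]; have [b' bB' h] := MB b bB.
apply/imsetP; exists b' => //; apply/setP => x; rewrite mem_translate !inE.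
by apply/esym/h; rewrite -[M]expr1 -(PD (x - 1) 1) subrK.
Qed.

End CyclicDesign.

(* Keeping only 30 columns from depth 2 on hardly affects the certificate. *)
Definition refutation : cert_seq := Eval vm_compute in
  search_seq 84 [:: 0; 0; 30; 0; 0; 0; 0; 0; 0; 0; 0; 0; 0]%N root_lists.

(* Conversion is call-by-need here, and evaluates only the lists that the
   certificate looks at; [vm_compute] would build them all. *)
Lemma refutation_ok : check_seq refutation root_lists.
Proof. exact_no_check (erefl true). Qed.

Lemma no_exact_cover X : ~ exact_cover X.
Proof. exact: no_cover_of_check refutation_ok X. Qed.

Theorem theorem5p3 :
  ~ exists B : {set {set point 9}}, is_two_analog 3 B /\ is_cyclic B.
Proof.
move=> [B [design_B cyclic_B]].
have [Bk hBk] := cyclic_planes_of_design design_B cyclic_B.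
have [X hX] := cyclic_planes_cover hBk.
exact: no_exact_cover hX.
Qed.
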